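(* Assume $V\in L^1_{loc}(\Omega)$ is such that $Q_V\succeq0$ in $\Omega$. (i) Let $V$ be balanced in $\Omega$. Then $-\Delta+V$ is globally $L^2$-subcritical in $\Omega$ if it is $L^1$-subcritical in $\Omega$. (ii) $-\Delta+V$ is $L^1$-subcritical in $\Omega$ if it is globally $L^2$-subcritical in $\Omega$.
   Context: $\Omega$ is a domain (nonempty connected open set) in $\mathbb R^N$, $N\ge1$. $W^{1,\infty}_c(\Omega)$: Lipschitz functions with compact support in $\Omega$; $Q_V(\xi)=\int_\Omega\{|\nabla\xi|^2+V\xi^2\}\,dx$; $Q_V\succeq0$ in $\Omega$ means $Q_V(\xi)\ge0$ for all $\xi\in W^{1,\infty}_c(\Omega)$; then $\sqrt{Q_V}$ is a norm on $W^{1,\infty}_c(\Omega)$, and $\mathcal L_V(\Omega)=(W^{1,\infty}_c(\Omega),\sqrt{Q_V})$. $X\hookrightarrow Y$ means $X\subset Y$ with continuous inclusion. $-\Delta+V$ is $L^1$-subcritical in $\Omega$ if $Q_V\succeq0$ in $\Omega$ and $\mathcal L_V(\Omega)\hookrightarrow L^1_{loc}(\Omega)$. It is globally $L^2$-subcritical in $\Omega$ if $Q_V\succeq0$ in $\Omega$ and $\mathcal L_V(\Omega)\hookrightarrow L^2(\Omega;w\,dx)$ for some nonnegative weight $w\in L^1_{loc}(\Omega)$ with $1/w\in L^1_{loc}(\Omega)$. Balanced potentials. For a nonempty open $U\Subset\Omega$ (i.e. $\overline U$ a compact subset of $\Omega$) let $\mathcal B_V(\Omega;U)$ be the completion of $\mathcal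 L_V(\Omega;U)=(W^{1,\infty}_c(\Omega),\|\cdot\|^U_{V,\Omega})$, $\|\xi\|^U_{V,\Omega}=\sqrt{Q_V(\xi)}+\int_U|\xi|$, and let $\mathbf J_U:\mathcal B_V(\Omega;U)\to L^1(U)$ be the continuous extension of $\xi\mapsto\xi|_U$. For a closed ball $B\subset\Omega$ let $X_B$ be the completion of $C^2_c(B)$ ($C^2$ functions with compact support in the interior of $B$) in the $C^2(B)$ norm and $X_B^*$ its dual, with $L^1(B)$ viewed in $X_B^*$ through $g\mapsto(\varphi\mapsto\int_Bg\varphi)$. If $B\subset U$, the map $\xi\mapsto V\xi$ is continuous from $\mathcal L_V(\Omega;U)$ to $X_B^*$; let $\mathbb V_{B,U}:\mathcal B_V(\Omega;U)\to X_B^*$ be its continuous extension. $V\in L^1_{loc}(\Omega)$ is balanced in $\Omega$ if $Q_V\succeq0$ in $\Omega$ and for every closed ball $B\subset\Omega$ there is an open $U\Subset\Omega$ containing $B$ such that, for all $u\in\mathcal B_V(\Omega;U)$, $V\mathbf J_U(u)\in L^1(B)$ and $\mathbb V_{B,U}(u)=V\mathbf J_U(u)$ in $X_B^*$. *)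

(* Defs.v *)
From HB Require Import structures.
From mathcomp Require Import all_boot all_order all_algebra.
From mathcomp Require Import all_classical all_reals all_analysis.
Set Implicit Arguments.
Unset Strict Implicit.
Unset Printing Implicit Defensive.
Import Order.TTheory GRing.Theory Num.Theory.
Import numFieldNormedType.Exports.
Local Open Scope classical_set_scope.
Local Open Scope ring_scope.

(* Row vectors carry the product (= Borel) sigma-algebra, generated by the
   coordinates, mirroring the library's instance on tuples. *)
Section rV_measurable.
Context {d} {T : measurableType d} {n : nat}.
Let coord : 'I_n -> 'rV[T]_n -> T := fun i x => x ord0 i.

Let rV_set0 : g_sigma_preimage coord set0.
Proof. exact: sigma_algebra0. Qed.

Let rV_setC A : g_sigma_preimage coord A -> g_sigma_preimage coord (~` A).
Proof. exact: sigma_algebraC. Qed.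

Let rV_bigcup (F : (set 'rV[T]_n)^nat) :
  (forall i, g_sigma_preimage coord (F i)) ->
  g_sigma_preimage coord (\bigcup_i F i).
Proof. exact: sigma_algebra_bigcup. Qed.

HB.instance Definition _ := @isMeasurable.Build (measure_tuple_display d)
  'rV[T]_n (g_sigma_preimage coord) rV_set0 rV_setC rV_bigcup.

Lemma measurable_rV_coord (i : 'I_n) :
  measurable_fun [set: 'rV[T]_n] (fun x : 'rV[T]_n => x ord0 i).
Proof.
move=> _ Y mY; rewrite setTI; apply: sub_sigma_algebra => /=.
rewrite -bigcup_seq/=; exists i => /=; first by rewrite mem_index_enum.
by exists Y => //; rewrite setTI.
Qed.

Lemma measurable_fun_rV d' (S : measurableType d') (f : S -> 'rV[T]_n) :
  (forall i, measurable_fun [set: S] (fun s => f s ord0 i)) ->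
  measurable_fun [set: S] f.
Proof.
move=> mf _ Y mY; rewrite setTI.
have sub : \big[setU/set0]_(i < n) preimage_set_system setT (coord i) measurable
    `<=` [set A | measurable (f @^-1` A)].
  rewrite -bigcup_seq => A [i _ [B mB <-]] /=; rewrite setTI.
  by have := mf i measurableT B mB; rewrite setTI.
apply: (smallest_sub _ sub mY); split => /=.
- by rewrite preimage_set0.
- by move=> A mA /=; rewrite setTD preimage_setC; exact: measurableC.
- by move=> F mF /=; rewrite preimage_bigcup; exact: bigcup_measurable.
Qed.

End rV_measurable.

Section lebesgue_rV.
Context {R : realType}.

Definition rV_cons n (p : R * 'rV[R]_n) : 'rV[R]_n.+1 := row_mx p.1%:M p.2.

Definition rV_uncons n (x : 'rV[R]_n.+1) : R * 'rV[R]_n :=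
  (x ord0 ord0, \row_(i < n) x ord0 (lift ord0 i)).

Lemma rV_consE0 n (p : R * 'rV[R]_n) : rV_cons p ord0 ord0 = p.1.
Proof.
rewrite /rV_cons mxE; case: splitP => [j _|j //].
by rewrite (ord1 j) mxE eqxx mulr1n.
Qed.

Lemma rV_consES n (p : R * 'rV[R]_n) (i : 'I_n) :
  rV_cons p ord0 (lift ord0 i) = p.2 ord0 i.
Proof.
rewrite /rV_cons mxE; case: splitP => [j|j]; first by rewrite (ord1 j).
by rewrite /= /bump add1n => -[ij]; congr (p.2 _ _); exact/val_inj.
Qed.

Lemma measurable_rV_cons n : measurable_fun setT (@rV_cons n).
Proof.
apply: measurable_fun_rV => i.
have [j ->|->] := unliftP ord0 i.
  under eq_fun do rewrite rV_consES.
  exact: (measurableT_comp (measurable_rV_coord j) measurable_snd).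
by under eq_fun do rewrite rV_consE0; exact: measurable_fst.
Qed.

Lemma measurable_rV_uncons n : measurable_fun setT (@rV_uncons n).
Proof.
apply: measurable_fun_pair => /=; first exact: measurable_rV_coord.
apply: measurable_fun_rV => i; under eq_fun do rewrite mxE.
exact: measurable_rV_coord.
Qed.

Lemma rV_consK n : cancel (@rV_cons n) (@rV_uncons n).
Proof.
move=> [a x]; rewrite /rV_uncons rV_consE0; congr pair.
by apply/rowP => i; rewrite mxE rV_consES.
Qed.

Section step.
Variables (n : nat) (mu : {sigma_finite_measure set 'rV[R]_n -> \bar R}).

Definition lebesgue_rV_step : set 'rV[R]_n.+1 -> \bar R :=
  pushforward (@lebesgue_measure R \x mu)%E (@rV_cons n).

Let step0 : lebesgue_rV_step set0 = 0%E.
Proof. by rewrite /lebesgue_rV_step /pushforward preimage_set0 measure0. Qed.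

Let step_ge0 A : (0 <= lebesgue_rV_step A)%E.
Proof. by rewrite /lebesgue_rV_step /pushforward measure_ge0. Qed.

Let step_sigma_additive : semi_sigma_additive lebesgue_rV_step.
Proof.
move=> F mF tF mUF; rewrite /lebesgue_rV_step /pushforward preimage_bigcup.
have mpre A : measurable A -> measurable (@rV_cons n @^-1` A).
  by move=> mA; rewrite -[X in measurable X]setTI; exact: measurable_rV_cons.
apply: measure_semi_sigma_additive.
- by move=> k; exact: mpre.
- apply/trivIsetP => /= i j _ _ ij; rewrite -preimage_setI.
  by move/trivIsetP : tF => /(_ _ _ _ _ ij) ->//; rewrite preimage_set0.
- by rewrite -preimage_bigcup; exact: mpre.
Qed.

HB.instance Definition _ := isMeasure.Build _ _ _ lebesgue_rV_step
  step0 step_ge0 step_sigma_additive.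

Let step_sigma_finite : sigma_finite setT lebesgue_rV_step.
Proof.
have [F FT Foo] : sigma_finite setT (@lebesgue_measure R \x mu)%E.
  have /sigma_finiteP[F [TF ndF Foo]] := sigma_finiteT (@lebesgue_measure R).
  have /sigma_finiteP[G [TG ndG Goo]] := sigma_finiteT mu.
  exists (fun k => F k `*` G k).
    rewrite -setXTT TF TG predeqE => -[x y]; split; last first.
      by move=> [k _ []/= ? ?]; split; exists k.
    move=> [/= [k _ Fkx] [l _ Gly]]; exists (maxn k l) => //; split.
    - by move: x Fkx; exact/subsetPset/ndF/leq_maxl.
    - by move: y Gly; exact/subsetPset/ndG/leq_maxr.
  move=> k; have [? ?] := Foo k; have [? ?] := Goo k.
  split; first exact: measurableX.
  by rewrite product_measure1E// lte_mul_pinfty// ge0_fin_numE.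
exists (fun k => @rV_uncons n @^-1` F k).
  by rewrite -preimage_bigcup -FT preimage_setT.
move=> k; have [mF Fk] := Foo k; split.
  by rewrite -[X in measurable X]setTI; exact: measurable_rV_uncons.
rewrite /lebesgue_rV_step /pushforward -comp_preimage.
by rewrite (_ : _ \o _ = id) //; apply/funext => p /=; rewrite rV_consK.
Qed.

HB.instance Definition _ := Measure_isSigmaFinite.Build _ _ _ lebesgue_rV_step
  step_sigma_finite.

End step.

(* N-dimensional Lebesgue measure on the Borel sets of R^N, as an iterated
   product.  Equivalence classes of Lebesgue measurable functions are thus
   represented by Borel functions. *)
Fixpoint lebesgue_rV n : {sigma_finite_measure set 'rV[R]_n -> \bar R} :=
  match n with
  | 0 => dirac (0 : 'rV[R]_0)
  | n'.+1 => lebesgue_rV_step (lebesgue_rV n')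
  end.

Lemma lebesgue_rV_box n (A : 'I_n -> set R) :
  (forall i, measurable (A i)) ->
  lebesgue_rV n [set x : 'rV[R]_n | forall i, A i (x ord0 i)]
  = (\prod_(i < n) lebesgue_measure (A i))%E.
Proof.
elim: n A => [|n IH] A mA /=.
  by rewrite big_ord0 diracE mem_set//= => -[].
rewrite /lebesgue_rV_step /pushforward big_ord_recl -IH//.
have mB : measurable
    [set x : 'rV[R]_n | forall i, A (lift ord0 i) (x ord0 i)].
  rewrite (_ : mkset _ = \bigcap_(i in [set: 'I_n])
      ((fun x : 'rV[R]_n => x ord0 i) @^-1` A (lift ord0 i))).
    apply: fin_bigcap_measurable => // i _.
    by rewrite -[X in measurable X]setTI; exact: measurable_rV_coord.
  by apply/seteqP; split => [x h i _|x h i]; exact: h.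
apply: etrans (product_measure1E lebesgue_measure (lebesgue_rV n) (mA ord0) mB).
congr (product_measure1 _ _ _); apply/seteqP; split => -[a x] /=.
  move=> h; split => [|i] /=; first by have := h ord0; rewrite rV_consE0.
  by have := h (lift ord0 i); rewrite rV_consES.
move=> [h0 h1] i; have [j ->|->] := unliftP ord0 i.
  by rewrite rV_consES.
by rewrite rV_consE0.
Qed.

End lebesgue_rV.

(* A space of functions with its norm, or with a family of seminorms generating
   its topology.  Only the values of the norms on the carrier matter. *)
Record snspace {R : realType} (E : lmodType R) := SNSpace {
  carrier : set E ;
  snorm : E -> \bar R }.

Record lcspace {R : realType} (E : lmodType R) := LCSpace {
  lc_carrier : set E ;
  lc_seminorms : set (E -> \bar R) }.

Section embeddings_completions.
Context {R : realType}.

Definition lc_of (E : lmodType R) (X : snspace E) : lcspace E :=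
  LCSpace (carrier X) [set snorm X].

Definition embeds (E : lmodType R) (X : snspace E) (Y : lcspace E) : Prop :=
  carrier X `<=` lc_carrier Y /\
  forall p, lc_seminorms Y p -> forall x, carrier X x ->
  forall e : R, 0 < e -> exists2 d : R, 0 < d &
    forall y, carrier X y ->
      (snorm X (y - x)%R < d%:E)%E -> (p (y - x)%R < e%:E)%E.

(* Continuous linear functionals.  They are functions on all of E, but only
   their values on the carrier of X are relevant. *)
Definition cont_dual (E : lmodType R) (X : snspace E) : snspace (E -> R^o) :=
  SNSpace
    [set l : E -> R^o |
      (forall (a : R) x y, carrier X x -> carrier X y ->
         l (a *: x + y) = a * l x + l y) /\
      (exists C : R, forall x, carrier X x ->
         (`|l x|%:E <= C%:E * snorm X x)%E)]
    (fun l => ereal_sup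
      [set `|l x|%:E | x in [set x | carrier X x /\ (snorm X x <= 1)%E]]).

Section completion.
Context (E : lmodType R) (X : snspace E).

Definition cauchy_seqs : set (E^nat) :=
  [set u | (forall n, carrier X (u n)) /\
    forall e : R, 0 < e ->
      exists n0, forall m n, (n0 <= m)%N -> (n0 <= n)%N ->
        (snorm X (u m - u n)%R < e%:E)%E].

Definition cauchy_class (u : E^nat) : set (E^nat) :=
  [set v | cauchy_seqs v /\ snorm X (u n - v n) @[n --> \oo] --> 0%E].

(* The points of the completion are the equivalence classes of Cauchy
   sequences. *)
Definition completion : set (set (E^nat)) := cauchy_class @` cauchy_seqs.

Definition completion_inj (x : E) : set (E^nat) := cauchy_class (fun=> x).

(* [xget (fun=> 0) c] is a representative of the class [c]. *)
Definition completion_dist (c c' : set (E^nat)) : \bar R :=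
  lim (snorm X (xget (fun=> 0) c n - xget (fun=> 0) c' n) @[n --> \oo]).

Definition is_continuous_extension (E' : lmodType R) (Y : snspace E')
    (T0 : E -> E') (T : set (E^nat) -> E') : Prop :=
  [/\ forall c, completion c -> carrier Y (T c),
      forall x, carrier X x -> snorm Y (T (completion_inj x) - T0 x) = 0%E &
      forall c, completion c -> forall e : R, 0 < e -> exists2 d : R, 0 < d &
        forall c', completion c' -> (completion_dist c c' < d%:E)%E ->
          (snorm Y (T c' - T c)%R < e%:E)%E].

(* The extension is unique up to elements of Y of norm 0 (for Y = L^1(U): up to
   a.e. equality); some representative is chosen. *)
Definition continuous_extension (E' : lmodType R) (Y : snspace E')
    (T0 : E -> E') : set (E^nat) -> E' :=
  xget (fun=> 0) [set T | is_continuous_extension Y T0 T].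

End completion.
End embeddings_completions.

(* The topology of 'rV[R]_N is that of R^N; its library norm is the sup norm,
   which defines the same Lipschitz functions as the Euclidean one.  Balls and
   gradients below are Euclidean.  Functions on Omega are represented by
   functions on R^N, those with compact support in Omega being extended by 0. *)
Section potentials.
Context {R : realType} {N : nat}.
Local Notation Rn := 'rV[R]_N.
Local Notation F := (Rn -> R^o).
Local Notation leb := (@lebesgue_rV R N).
Implicit Types (Omega U B K : set Rn) (V w : Rn -> R) (xi phi : F).

Definition is_domain Omega : Prop :=
  [/\ Omega !=set0, open Omega & connected Omega].

Definition closed_eball (a : Rn) (r : R) : set Rn :=
  [set x | \sum_(i < N) (x ord0 i - a ord0 i) ^+ 2 <= r ^+ 2].

Definition supp xi : set Rn := closure [set x | xi x != 0].

Definition compactly_contained U Omega : Prop :=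
  compact (closure U) /\ closure U `<=` Omega.

(* The total function 'D_v takes a fixed value where the derivative does not
   exist; for a Lipschitz function this concerns a null set only. *)
Definition pderiv (i : 'I_N) xi : F := 'D_(delta_mx ord0 i) xi.

Definition L1loc Omega (f : Rn -> \bar R) : Prop :=
  forall K, compact K -> K `<=` Omega -> leb.-integrable K f.

Definition L1 U : snspace F :=
  SNSpace [set f : F | leb.-integrable U (EFin \o f)]
    (fun f => \int[leb]_(x in U) `|f x|%:E)%E.

Definition L1loc_space Omega : lcspace F :=
  LCSpace [set f : F | L1loc Omega (EFin \o f)]
    [set snorm (L1 K) | K in [set K | compact K /\ K `<=` Omega]].

Definition L2_weighted Omega w : snspace F :=
  SNSpace
    [set f : F | measurable_fun Omega f /\
      (\int[leb]_(x in Omega) (w x * f x ^+ 2)%:E < +oo)%E]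
    (fun f => (\int[leb]_(x in Omega) (w x * f x ^+ 2)%:E) `^ 2^-1)%E.

Definition W1infc Omega : set F :=
  [set xi | [/\ lipschitz xi, compact (supp xi) & supp xi `<=` Omega]].

Definition Q Omega V xi : R :=
  \int[leb]_(x in Omega) ((\sum_(i < N) pderiv i xi x ^+ 2) + V x * xi x ^+ 2).

Definition Q_nonneg Omega V : Prop :=
  forall xi, W1infc Omega xi -> 0 <= Q Omega V xi.

Definition LV Omega V : snspace F :=
  SNSpace (W1infc Omega) (fun xi => (Num.sqrt (Q Omega V xi))%:E).

Definition L1_subcritical Omega V : Prop :=
  Q_nonneg Omega V /\ embeds (LV Omega V) (L1loc_space Omega).

(* The inverse is the one of \bar R, for which 0^-1 = +oo: the third condition
   forces w > 0 a.e. *)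
Definition globally_L2_subcritical Omega V : Prop :=
  Q_nonneg Omega V /\
  exists w, [/\ forall x, Omega x -> 0 <= w x,
    L1loc Omega (fun x => (w x)%:E),
    L1loc Omega (fun x => ((w x)%:E)^-1)%E &
    embeds (LV Omega V) (lc_of (L2_weighted Omega w))].

Definition LVU Omega V U : snspace F :=
  SNSpace (W1infc Omega)
    (fun xi => (snorm (LV Omega V) xi + snorm (L1 U) xi)%E).

Definition BV Omega V U : set (set (F^nat)) := completion (LVU Omega V U).

Definition JU Omega V U : set (F^nat) -> F :=
  continuous_extension (LVU Omega V U) (L1 U) id.

Definition C2 phi : Prop :=
  [/\ continuous phi,
      forall i x, derivable phi x (delta_mx ord0 i),
      forall i, continuous (pderiv i phi),
      forall i j x, derivable (pderiv i phi) x (delta_mx ord0 j) &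
      forall i j, continuous (pderiv j (pderiv i phi))].

Definition C2norm B phi : \bar R :=
  let supB (f : F) := ereal_sup [set `|f x|%:E | x in B] in
  (supB phi + \sum_(i < N) supB (pderiv i phi)
   + \sum_(i < N) \sum_(j < N) supB (pderiv j (pderiv i phi)))%E.

Definition C2c B : set F :=
  [set phi | [/\ C2 phi, compact (supp phi) & supp phi `<=` interior B]].

(* The completion of C2c B is realised as its closure in C^2(B): the limits of
   functions of C2c B, extended by 0, are C^2 on R^N and vanish outside B. *)
Definition XB B : snspace F :=
  SNSpace
    [set phi : F | [/\ C2 phi, forall x, ~ B x -> phi x = 0 &
      exists2 phi_ : F^nat, forall n, C2c B (phi_ n) &
        C2norm B (phi_ n - phi) @[n --> \oo] --> 0%E]]
    (C2norm B).

(* g in L^1(B) viewed as an element of the dual of XB B. *)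
Definition L1_functional B (g : F) : F -> R^o :=
  fun phi => \int[leb]_(x in B) (g x * phi x).

Definition VBU Omega V B U : set (F^nat) -> (F -> R^o) :=
  continuous_extension (LVU Omega V U) (cont_dual (XB B))
    (fun xi => L1_functional B (fun x => V x * xi x)).

Definition balanced Omega V : Prop :=
  Q_nonneg Omega V /\
  forall a r, 0 < r -> closed_eball a r `<=` Omega ->
  let B := closed_eball a r in
  exists U, [/\ open U, compactly_contained U Omega, B `<=` U &
    forall u, BV Omega V U u ->
      let VJu : F := fun x => V x * JU Omega V U u x in
      carrier (L1 B) VJu /\
      forall phi, carrier (XB B) phi ->
        VBU Omega V B U u phi = L1_functional B VJu phi].

End potentials.

(* Main.v *)
Require Import Defs.
From HB Require Import structures.
From mathcomp Require Import all_boot all_order all_algebra.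
From mathcomp Require Import all_classical all_reals all_analysis.
From mathcomp Require Import measurable_realfun ring lra.
Import Order.TTheory GRing.Theory Num.Theory.
Import numFieldNormedType.Exports.
Local Open Scope classical_set_scope.
Local Open Scope ring_scope.
Set Implicit Arguments.
Unset Strict Implicit.
Unset Printing Implicit Defensive.

(** The implication from global weighted L^2 control to local L^1 control is
Young's inequality |z| <= s / w + w z^2 / (4 s): integrated over a compact set,
its first term is small for small s because 1 / w is locally integrable, and
its second term is controlled by the energy ([weighted_young],
[L1_subcritical_of_weighted]).

For the converse, L^1-subcriticality yields a bounded source f, bounded below by
a positive constant on every compact set, such that the integral of f |u| is at
most the square root of Q(u) ([weight_exists]).  Formally, the equation
- Delta g + V g = f then has a positive solution g, and testing it with
xi^2 / g gives the Hardy inequality: the integral of (f / g) xi^2 is at most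
Q(xi).  The weight is w = f / g.  It is locally integrable by the Hardy
inequality applied to cutoff functions, and 1 / w = g / f is locally integrable
because f g is integrable and f is locally bounded below.

The solution g itself is never shown to satisfy an equation: the test is made on
approximations of g.  The functional Q(u) / 2 - (integral of f u) is bounded
below by - 1 / 2, and u_k minimizes it among nonnegative functions up to an
error eta_k ([near_minimizer]).

- By the parallelogram identity Q(u_(k+1) - u_k) is of the order of eta_k
  ([near_minimizer_close]), so the integrals of f |u_(k+1) - u_k| are summable
  and u_k converges almost everywhere to a limit g such that f g is integrable
  ([ground_cvg], [integral_ground]).
- Since u_k is Lipschitz and nonnegative, phi_k = xi^2 / (u_k + eps_k) is an
  admissible nonnegative direction.  Comparing u_k with u_k + t_k phi_k bounds
  the integral of f phi_k by B(u_k, phi_k) + (t_k / 2) Q(phi_k) + eta_k / t_k,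
  where B is the bilinear form of Q.  Picone's identity, perturbed by the term
  with Q(phi_k), bounds this in turn by the Dirichlet integral of xi plus the
  integral of V xi^2 u_k / (u_k + eps_k), up to terms that vanish in the limit
  ([picone_pointwise], [key_estimate]).  Minimality among nonnegative functions
  is enough for this, as only one sign of the variation is needed.
- Fatou's lemma on the left forces g > 0 almost everywhere ([ground_pos]): where
  g vanishes and xi does not, f phi_k tends to infinity.  Dominated convergence
  on the right then gives the Hardy inequality ([hardy_inequality]).

All computations with gradients need the partial derivatives of a Lipschitz
function to exist almost everywhere.  On the line, a Lipschitz function plus a
steep linear one is nondecreasing; its Stieltjes measure is absolutely
continuous, and Lebesgue's differentiation theorem applies to its density
([lipschitz_ae_derivable]).  In R^n, a set whose trace on every line in a
coordinate direction is null is itself null ([null_of_null_lines]). *)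

(** * Lipschitz functions of one variable *)

Section Lipschitz_1D.
Context {R : realType}.
Local Notation mu := (@lebesgue_measure R).

(** Compare term by term, in any cover by half-open intervals, the increments of
[g] with [L] times the lengths. *)
Lemma lipschitz_stieltjes_le (g : cumulative R R) (L : R) :
  0 < L -> (forall x y, x <= y -> g y - g x <= L * (y - x)) ->
  forall A, (lebesgue_stieltjes_measure g A <= L%:E * mu A)%E.
Proof.
move=> L0 gL A; rewrite muleC -lee_pdivrMr//.
apply/le_ereal_inf_tmp => _ [F [mF AF] <-].
rewrite lee_pdivrMr// muleC -nneseriesZl; last first.
  by move=> i _; exact: wlength_ge0.
apply: (@le_trans _ _ (\sum_(k <oo) wlength g (F k))%E).
  by apply: ereal_inf_lbound; exists F.
apply: lee_nneseries => [k _ _|k _]; first exact: wlength_ge0.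
move: (mF k) => /ocitvP [->|[x xy ->]].
  by rewrite (wlength0 g) mule_ge0 ?wlength_ge0 ?lee_fin ?ltW.
have wE (f : R -> R) : wlength f `]x.1, x.2]%classic = (f x.2 - f x.1)%:E.
  exact/wlength_itv_bnd/ltW.
apply: (@le_trans _ _ (L%:E * (x.2 - x.1)%:E)%E).
  by rewrite (wE g) -EFinM lee_fin; apply: gL; exact: ltW.
by rewrite -[(x.2 - x.1)%:E](wE idfun).
Qed.

(** [f x + (L + 1) * x] is nondecreasing and Lipschitz, so its Stieltjes measure
restricted to a bounded interval has a Radon-Nikodym density with respect to
Lebesgue measure.  On that interval the function is a primitive of the density,
hence derivable almost everywhere. *)
Lemma lipschitz_ae_derivable (f : R -> R) (L : R) :
  (forall x y, `|f x - f y| <= L * `|x - y|) ->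
  {ae mu, forall x, derivable f x 1}.
Proof.
move=> fL.
have L0 : 0 <= L.
  by have := fL 1 0; rewrite subr0 normr1 mulr1; apply: le_trans.
(* L + 1 rather than L: it makes the Lipschitz constant of g positive. *)
pose g x := f x + (L + 1) * x.
have gnd : nondecreasing g.
  move=> x y xy; have := fL y x; rewrite ler_norml => /andP[+ _].
  rewrite ger0_norm ?subr_ge0// /g; nra.
have gL x y : x <= y -> g y - g x <= (2 * L + 1) * (y - x).
  move=> xy; have := fL y x; rewrite ler_norml => /andP[_].
  rewrite ger0_norm ?subr_ge0// /g; nra.
have cg : continuous g.
  move=> x; apply/cvgrPdist_le => e e0; near=> y.
  apply: (@le_trans _ _ ((2 * L + 1) * `|x - y|)).
    have [xy|/ltW yx] := leP x y.
      rewrite ler0_norm ?subr_le0 ?gnd// opprB.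
      by rewrite ler0_norm ?subr_le0// opprB gL.
    by rewrite !ger0_norm ?subr_ge0 ?gnd// gL.
  rewrite mulrC -ler_pdivlMr; last by lra.
  near: y; apply: cvgr_dist_le; first exact: cvg_id.
  by rewrite divr_gt0//; lra.
pose gc := HB.pack_for (cumulative R R) g
  (isCumulative.Build R _ R g gnd (right_continuousW cg)).
pose nu : {measure set (measurableTypeR R) -> \bar R} := lebesgue_stieltjes_measure gc.
have nule A : (nu A <= (2 * L + 1)%:E * mu A)%E.
  by apply: lipschitz_stieltjes_le; [lra|exact: gL].
suff main n : {ae mu, forall x, - n%:R < x < n%:R -> derivable g x 1}.
  have /ae_foralln := main; apply: filterS => x.
  move=> /(_ (Num.bound `|x|)) dg.
  have : derivable g x 1.
    by apply: dg; rewrite -ltr_norml; exact: archi_boundP.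
  move=> {}dg; have -> : f = g - (L + 1) \*: id.
    by apply/funext => y; rewrite /g /= fctE addrK.
  by apply: derivableB => //; apply: derivableZ; exact: derivable_id.
have [->|n0] := posnP n.
  by apply: aeW => x /=; rewrite oppr0 => /andP[/lt_trans h /h]; rewrite ltxx.
pose D := `]- n%:R, n%:R]%classic : set R.
have mD : measurable (D : set (measurableTypeR R)) by exact: measurable_itv.
have Dfin : (nu D < +oo)%E.
  apply: (le_lt_trans (nule _)); rewrite lebesgue_measure_itv/=.
  by case: ifP => _; rewrite ?mule0// -EFinD -EFinM ltry.
pose nuD : {finite_measure set (measurableTypeR R) -> \bar R} := mfrestr mD Dfin.
have dom : nuD `<< mu.
  apply/null_content_dominatesP => A mA A0; rewrite /nuD /mfrestr /mrestr.
  apply/eqP; rewrite -measure_le0.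
  apply: le_trans (nule _) _; rewrite -[leRHS](mule0 ((2 * L + 1)%:E)).
  apply: lee_wpmul2l; first by rewrite lee_fin; lra.
  by rewrite measure_le0; apply/eqP/(subset_measure0 _ _ _ A0) => //; exact: measurableI.
have [h [h0 hfin hint hE]] := radon_nikodym_sigma_finite dom.
pose k (x : R) : R := fine (h x).
have kE : EFin \o k = h by apply/funext => x /=; rewrite /k fineK.
have kint : mu.-integrable setT (EFin \o k) by rewrite kE.
have : {ae mu, forall x : R, (BRight (- n%:R) < BRight x)%O ->
    derivable (fun y : R => \int[mu]_(t in `]- n%:R, y]) k t) x 1}.
  have ki (y : R) : mu.-integrable [set` Interval (BRight (- n%:R)) (BRight y)] (EFin \o k).
    exact: (integrableS measurableT).
  have kl : locally_integrable [set: R] k.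
    by apply: open_integrable_locally => //; exact: openT.
  apply: filterS (FTC1 ki kl); first exact: (ae_filter_ringOfSetsType mu).
  by move=> x H /H[].
apply: filterS; first exact: (ae_filter_ringOfSetsType mu).
move=> x H /andP[xn1 xn2].
have dF := H xn1.
have -> : g = g \- cst (g (- n%:R)) \+ cst (g (- n%:R)).
  by apply/funext => y /=; rewrite subrK.
apply: derivableD => //; apply: near_eq_derivable dF.
have nx : \forall y \near x, y \in `]- n%:R, n%:R[ by apply: near_in_itvoo; rewrite in_itv/= xn1.
near=> y; have : y \in `]- n%:R, n%:R[ by near: y.
rewrite in_itv/= => /andP[yn1 yn2]; rewrite /Rintegral.
rewrite [X in fine X](_ : _ = nuD (`]- n%:R, y]%classic : set R)); last first.
  rewrite hE; last exact: measurable_itv.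
  by apply: eq_integral => t _; rewrite -kE.
have -> : nuD (`]- n%:R, y]%classic : set R) = nu (`]- n%:R, y]%classic `&` D) by [].
rewrite setIidl; last by apply: subset_itvl; rewrite bnd_simp; exact: ltW.
rewrite [nu _](_ : _ = wlength gc `]- n%:R, y]%classic); last first.
  by apply: measurable_mu_extE; exact: is_ocitv.
by rewrite wlength_itv_bnd ?ltW.
Unshelve. all: by end_near. Qed.
End Lipschitz_1D.

(** * Lebesgue measure and the topology of row vectors *)

Section rV_topology_measure.
Context {R : realType} {n : nat}.
Local Notation Rn := 'rV[R]_n.
Local Notation leb := (@lebesgue_rV R n).

Lemma coord_le_norm (x : Rn) (i : 'I_n) : `|x ord0 i| <= `|x|.
Proof.
rewrite [leRHS]mx_normrE.
exact: (le_bigmax _ (fun ij => `|x ij.1 ij.2|) (ord0, i)).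
Qed.

Lemma measurable_ball_rV (a : Rn) (e : R) : measurable (ball a e : set Rn).
Proof.
rewrite (_ : ball a e = (if 0 < e then \bigcap_(i in [set: 'I_n])
  ((fun x : Rn => x ord0 i) @^-1` ball (a ord0 i) e) else set0)).
  case: ifP => // _; apply: fin_bigcap_measurable => // i _.
  rewrite -[X in measurable X]setTI; apply: measurable_rV_coord => //.
  by apply: open_measurable; exact: ball_open.
apply/seteqP; split => x.
  move=> [e0 ax]; rewrite e0 => i _; exact: ax.
case: ifP => // e0 ax; split => // i j; rewrite (ord1 i); exact: ax.
Qed.

(** The sigma-algebra is generated by the coordinates; an open set is the union
of the balls with rational centre and rational radius that it contains. *)
Lemma open_measurable_rV (U : set Rn) : open U -> measurable U.
Proof.
move=> oU.
pose F (k : nat) : set Rn := if unpickle k is Some (q, r) then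
    let B := ball (map_mx ratr q : Rn) (ratr r : R) in
    if `[< B `<=` U >] then B else set0
  else set0.
rewrite (_ : U = \bigcup_k F k); last first.
  apply/seteqP; split => [x Ux|x [k _]]; last first.
    rewrite /F; case: unpickle => // -[q r] /=.
    by case: ifPn => // /asboolP BU /BU.
  have [e /= e0 eU] : nbhs_ball x U by apply/nbhs_ballP; exact: open_nbhs_nbhs.
  have e20 : (0 : R) < e / 2 by rewrite divr_gt0.
  have [r] := rat_in_itvoo e20; rewrite in_itv/= => /andP[r0 re].
  have /choice[q qP] : forall i : 'I_n, exists q : rat, `|x ord0 i - ratr q| < ratr r :> R.
    move=> i; have : x ord0 i - ratr r < x ord0 i + ratr r by rewrite ltrD2l gtrN.
    move=> /rat_in_itvoo[q]; rewrite in_itv/= => /andP[q1 q2]; exists q.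
    by rewrite ltr_norml; lra.
  exists (pickle (\row_i q i, r)) => //; rewrite /F pickleK/=.
  set B := ball _ _.
  have BU : B `<=` U.
    move=> y [_ By]; apply: eU; split => // i j; rewrite (ord1 i).
    have := By ord0 j; rewrite !mxE /ball/= => h.
    rewrite /ball/= -(subrK (ratr (q j)) (x ord0 j)) -addrA.
    rewrite (le_lt_trans (ler_normD _ _))//.
    by rewrite [ltRHS]splitr ltrD// (lt_trans _ re)//; exact: qP.
  rewrite asboolT//; split => // i j; rewrite (ord1 i) !mxE /ball/= distrC; exact: qP.
apply: bigcup_measurable => k _; rewrite /F.
case: unpickle => // -[q r] /=; case: ifP => // _; exact: measurable_ball_rV.
Qed.

Lemma closed_measurable_rV (A : set Rn) : closed A -> measurable A.
Proof.
by move=> cA; rewrite -(setCK A); apply: measurableC; apply: open_measurable_rV;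
  rewrite openC.
Qed.

Lemma compact_measurable_rV (A : set Rn) : compact A -> measurable A.
Proof.
move=> cA; apply: closed_measurable_rV.
exact: (compact_closed (@norm_hausdorff R Rn) cA).
Qed.

Lemma continuous_measurable_rV (f : Rn -> R) : continuous f -> measurable_fun setT f.
Proof.
move=> cf; apply: (measurability _ (RGenOpens.measurableE R)).
move=> _ [_ [a [b ->] <-]]; rewrite setTI; apply: open_measurable_rV.
move/continuousP : cf; apply; exact: interval_open.
Qed.

Lemma compact_finite_measure_rV (K : set Rn) : compact K -> (leb K < +oo)%E.
Proof.
move=> cK; have /pinfty_ex_gt0[M M0 KM] := compact_bounded cK.
apply: (@le_lt_trans _ _ (leb [set x : Rn | forall i, `[- M, M]%classic (x ord0 i)])).
  apply: le_measure; rewrite ?inE.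
  - exact: compact_measurable_rV.
  - rewrite (_ : mkset _ = \bigcap_(i in [set: 'I_n])
      ((fun x : Rn => x ord0 i) @^-1` `[- M, M]%classic)).
      apply: fin_bigcap_measurable => // i _.
      by rewrite -[X in measurable X]setTI; apply: measurable_rV_coord.
    by apply/seteqP; split => [x h i _|x h i]; exact: h.
  - move=> x Kx i /=; rewrite in_itv/= -ler_norml.
    apply: le_trans (KM _ Kx).
    exact: coord_le_norm.
rewrite (lebesgue_rV_box (A := fun=> `[- M, M]%classic))//.
rewrite (eq_bigr (fun=> (M + M)%:E)); last first.
  by move=> i _; rewrite lebesgue_measure_itv/= lte_fin gtrN// -EFinB opprK.
rewrite ltey_eq; apply/orP; left.
by elim/big_rec : _ => // i x _ xf; rewrite fin_numM.
Qed.
End rV_topology_measure.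

(** Fubini, by induction on the dimension: the first coordinate is either the
direction of the lines, and is then integrated first, or a parameter, and the
induction hypothesis applies to each slice. *)
Lemma null_of_null_lines (R : realType) n (i : 'I_n) (E : set 'rV[R]_n) :
  measurable E ->
  (forall x : 'rV[R]_n,
    lebesgue_measure [set t : R | E (x + t *: delta_mx ord0 i)] = 0%E) ->
  lebesgue_rV n E = 0%E.
Proof.
elim: n i E => [[]//|n IH] i E mE E0 /=.
rewrite /lebesgue_rV_step /pushforward.
set A := _ @^-1` _.
have mA : measurable A.
  by rewrite -[X in measurable X]setTI; exact: measurable_rV_cons.
have [j ij|i0] := unliftP ord0 i.
  rewrite /product_measure1 integral0_eq// => t _ /=.
  apply: (IH j); first exact: measurable_xsection.
  move=> y; rewrite -(E0 (rV_cons (t, y))); congr lebesgue_measure.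
  apply/seteqP.
  have consE s : rV_cons (t, y + s *: delta_mx ord0 j) =
      rV_cons (t, y) + s *: delta_mx ord0 i.
    apply/rowP => k; have [l ->|->] := unliftP ord0 k.
      by rewrite ij [RHS]mxE !rV_consES/= !mxE (inj_eq lift_inj).
    by rewrite ij [RHS]mxE !rV_consE0/= !mxE/= mulr0 addr0.
  split=> s /=; rewrite /xsection/= inE /A/= consE//.
transitivity (product_measure2 lebesgue_measure (lebesgue_rV n) A).
  by apply: product_measure_unique => //= B C mB mC; rewrite product_measure2E.
rewrite /product_measure2 integral0_eq// => y _ /=.
rewrite -(E0 (rV_cons (0, y))); congr lebesgue_measure.
have consE s : rV_cons (s, y) = rV_cons (0, y) + s *: delta_mx ord0 i.
  apply/rowP => k; have [l ->|->] := unliftP ord0 k.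
    by rewrite i0 [RHS]mxE !rV_consES/= !mxE/= mulr0 addr0.
  by rewrite i0 [RHS]mxE !rV_consE0/= !mxE/= mulr1 add0r.
by apply/seteqP; split=> s /=; rewrite /ysection/= inE /A/= (consE s).
Qed.

(** * Partial derivatives of Lipschitz functions *)

Lemma exists_invS_lt {R : realType} (r : R) : 0 < r -> exists m, m.+1%:R^-1 < r.
Proof.
move=> r0; exists (Num.bound r^-1); rewrite invf_plt ?posrE//.
have : r^-1 < (Num.bound r^-1)%:R by apply: archi_boundP; rewrite invr_ge0 ltW.
by move=> /lt_le_trans; apply; rewrite ler_nat.
Qed.

Section lipschitz_partial_derivatives.
Context {R : realType} {n : nat}.
Local Notation Rn := 'rV[R]_n.
Local Notation F := (Rn -> R^o).
Local Notation leb := (@lebesgue_rV R n).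
Local Notation e_ i := (delta_mx ord0 i : Rn).

Lemma lipschitzP (f : F) : lipschitz f <->
  exists2 L : R, 0 <= L & forall x y, `|f x - f y| <= L * `|x - y|.
Proof.
split=> [/pinfty_ex_gt0[L L0 fL]|[L L0 fL]].
  by exists L; [exact: ltW|move=> x y; exact: (fL (x, y))].
apply: (@klipschitzW _ _ _ L); first exact: (@globally_properfilter _ _ (0, 0)).
by move=> [x y] _; exact: fL.
Qed.

Lemma norm_delta_le1 (i : 'I_n) : `|e_ i| <= 1.
Proof.
rewrite [leLHS]mx_normrE; apply: bigmax_le => // -[j k] _ /=.
by rewrite mxE; case: (_ && _) => /=; rewrite ?normr1 ?normr0.
Qed.

Lemma lipschitz_continuous (f : F) : lipschitz f -> continuous f.
Proof.
move=> /lipschitzP[L L0 fL] x /= A /nbhs_ballP[e /= e0 eA].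
have L1 : 0 < L + 1 by lra.
apply/nbhs_ballP; exists (e / (L + 1)); first by rewrite /= divr_gt0.
move=> y; rewrite -ball_normE /= => xy; apply: eA; rewrite /ball/=.
apply: (@le_lt_trans _ _ ((L + 1) * `|x - y|)).
  by apply: le_trans (fL _ _) _; rewrite ler_wpM2r ?lerDl.
by rewrite mulrC -ltr_pdivlMr.
Qed.

Definition dquot (i : 'I_n) (f : F) (h : R) (x : Rn) : R :=
  h^-1 * (f (h *: e_ i + x) - f x).

Lemma dquotE i f x : (fun h : R => h^-1 *: ((f \o shift x) (h *: e_ i) - f x) : R^o) =
  dquot i f ^~ x.
Proof. by []. Qed.

Lemma dquot_bound i (f : F) L h x : 0 <= L ->
  (forall x y, `|f x - f y| <= L * `|x - y|) -> `|dquot i f h x| <= L.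
Proof.
move=> L0 fL; rewrite /dquot; have [->|h0] := eqVneq h 0.
  by rewrite invr0 mul0r normr0.
rewrite normrM normfV mulrC ler_pdivrMr ?normr_gt0//.
apply: le_trans (fL _ _) _; rewrite addrK normrZ ler_wpM2l//.
by rewrite ler_piMr// norm_delta_le1.
Qed.

(** Where the derivative does not exist the limit takes the default value 0, for
which the bound holds as well. *)
Lemma pderiv_bound i (f : F) L x : 0 <= L ->
  (forall x y, `|f x - f y| <= L * `|x - y|) -> `|pderiv i f x| <= L.
Proof.
move=> L0 fL; rewrite /pderiv /derive dquotE.
have [cf|ncf] := pselect (cvg (dquot i f ^~ x @ 0^')); last first.
  by rewrite (dvgP ncf) normr0.
rewrite -lim_norm//.
apply: limr_le; first exact: is_cvg_norm.
by near=> h; exact: dquot_bound.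
Unshelve. all: by end_near. Qed.


Lemma continuous_dquot i (f : F) h : continuous f -> continuous (dquot i f h).
Proof.
move=> cf x; have Fx := nbhs_filter x.
apply: (@cvgM _ _ _ _ (fun=> h^-1) (fun y => f (h *: e_ i + y) - f y)).
  exact: cvg_cst.
apply: (@cvgB _ _ _ _ _ (fun y => f (h *: e_ i + y)) f); last exact: cf.
apply: (@continuous_comp _ _ _ (fun y : Rn => h *: e_ i + y) f); last exact: cf.
by apply: (@cvgD _ _ _ _ _ (fun=> h *: e_ i) id); [exact: cvg_cst|exact: cvg_id].
Qed.

Lemma continuous_dquot_step i (f : F) x h : h != 0 -> continuous f ->
  {for h, continuous (dquot i f ^~ x)}.
Proof.
move=> h0 cf.
apply: (@cvgM _ _ _ _ (fun k => k^-1) (fun k => f (k *: e_ i + x) - f x)).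
  by apply: cvgV => //; exact: cvg_id.
apply: (@cvgB _ _ _ _ _ (fun k => f (k *: e_ i + x)) (fun=> f x)); last exact: cvg_cst.
apply: (@continuous_comp _ _ _ (fun k : R => k *: e_ i + x) f); last exact: cf.
apply: (@cvgD _ _ _ _ _ (fun k : R => k *: e_ i) (fun=> x)); last exact: cvg_cst.
by apply: (@cvgZ _ _ _ _ _ id (fun=> e_ i)); [exact: cvg_id|exact: cvg_cst].
Qed.

(** Steps are restricted to the rationals to make the intersection countable. *)
Definition dquot_osc_le i (f : F) (k m : nat) : set Rn :=
  \bigcap_(pq in [set: rat * rat])
    (if [&& pq.1 != 0, pq.2 != 0, `|ratr pq.1| < m.+1%:R^-1 :> R &
           `|ratr pq.2| < m.+1%:R^-1 :> R]
     then [set x | `|dquot i f (ratr pq.1) x - dquot i f (ratr pq.2) x|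
                   <= k.+1%:R^-1] else setT).

Lemma measurable_dquot_osc_le i f k m : continuous f ->
  measurable (dquot_osc_le i f k m).
Proof.
move=> cf; apply: closed_measurable_rV; apply: closed_bigI => -[p q] _ /=.
case: ifP => _; last exact: closedT.
have cq : continuous (fun x => `|dquot i f (ratr p) x - dquot i f (ratr q) x|).
  move=> x; have Fx := nbhs_filter x; apply: cvg_norm.
  by apply: (@cvgB _ _ _ _ Fx); exact: continuous_dquot.
exact: (preimage_closed (in1W cq) (@closed_le R k.+1%:R^-1)).
Qed.

(** The Cauchy criterion for the difference quotients.  They are continuous in
the step away from 0, so rational steps suffice. *)
Lemma derivable_osc i (f : F) : continuous f ->
  [set x | derivable f x (e_ i)] =
  \bigcap_k \bigcup_m dquot_osc_le i f k m.
Proof.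
move=> cf; apply/seteqP; split => x.
  rewrite /= /derivable dquotE => /cvg_ex[l fl] k _.
  have k0 : (0 : R) < k.+1%:R^-1 / 2 by rewrite divr_gt0// invr_gt0.
  have /cvgrPdist_le/(_ _ k0)[r /= r0 rl] := fl.
  have [m mr] := exists_invS_lt r0.
  exists m => // -[p q] _ /=; case: ifP => // /and4P[p0 q0 pm qm] /=.
  have P (s : rat) : s != 0 -> `|ratr s : R| < m.+1%:R^-1 ->
      `|l - dquot i f (ratr s) x| <= k.+1%:R^-1 / 2.
    move=> s0 sm; apply: rl => /=; last by rewrite fmorph_eq0.
    by rewrite sub0r normrN (lt_trans sm).
  have := lerD (P _ p0 pm) (P _ q0 qm); rewrite -splitr; apply: le_trans.
  rewrite (_ : dquot i f (ratr p) x - _ =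
    (l - dquot i f (ratr q) x) - (l - dquot i f (ratr p) x)); last by ring.
  by rewrite [leRHS]addrC ler_normB.
move=> xE /=; rewrite /derivable dquotE.
apply/cauchy_cvgP/cauchy_exP => e e0.
have e2 : 0 < e / 2 by rewrite divr_gt0.
have [k ke] := exists_invS_lt e2.
have [m _ xm] := xE k I.
have approx (h : R) (d : R) : h != 0 -> `|h| < m.+1%:R^-1 -> 0 < d ->
    exists q : rat, [/\ q != 0, `|ratr q : R| < m.+1%:R^-1 &
      `|dquot i f (ratr q) x - dquot i f h x| < d].
  move=> h0 hm d0.
  have : nbhs h [set t | t != 0 /\ `|t| < m.+1%:R^-1 /\
      `|dquot i f t x - dquot i f h x| < d].
    apply: filterI.
      by apply: (@open_nbhs_nbhs _ h [set t | t != 0]); split => //; exact: open_neq.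
    apply: filterI.
      by apply: (@cvgr_norm_lt _ R^o _ (nbhs h) _ id h _ _ hm); exact: cvg_id.
    have /cvgrPdist_lt/(_ _ d0) := continuous_dquot_step (i := i) (x := x) h0 cf.
    by apply: filterS => t /=; rewrite distrC.
  rewrite nbhsE => -[W [oW Wh] WP].
  have [t [Wt [q _ qt]]] := @dense_rat R W (ex_intro _ h Wh) oW.
  have [t0 [tm td]] := WP _ Wt.
  by exists q; rewrite qt; split=> //; move: t0; rewrite -qt fmorph_eq0.
(* Any fixed small step serves as the centre of the Cauchy criterion. *)
pose h0 : R := m.+2%:R^-1.
have h00 : h0 != 0 by rewrite invr_eq0 pnatr_eq0.
have h0m : `|h0| < m.+1%:R^-1.
  by rewrite ger0_norm ?invr_ge0// ltf_pV2 ?posrE// ltr_nat.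
exists (dquot i f h0 x).
suff: \forall h \near 0^', `|dquot i f h x - dquot i f h0 x| < e.
  by apply: filterS => h; rewrite /ball/= distrC.
near=> h.
have hn0 : h != 0 by near: h; exact: nbhs_dnbhs_neq.
have hm : `|h| < m.+1%:R^-1.
  by near: h; apply: dnbhs0_lt; rewrite invr_gt0.
have e4 : 0 < e / 4 by rewrite divr_gt0.
have [q [q0 qm qh]] := approx h (e / 4) hn0 hm e4.
have [q' [q'0 q'm q'h]] := approx h0 (e / 4) h00 h0m e4.
have /= := xm (q, q') I; rewrite q0 q'0 qm q'm /= => qq'.
rewrite (_ : dquot i f h x - _ = (dquot i f h x - dquot i f (ratr q) x)
  + (dquot i f (ratr q) x - dquot i f (ratr q') x)
  + (dquot i f (ratr q') x - dquot i f h0 x)); last by ring.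
rewrite (le_lt_trans (ler_normD _ _))//.
rewrite (le_lt_trans (lerD (ler_normD _ _) (lexx _)))//.
have -> : e = e / 4 + e / 2 + e / 4 by lra.
apply: ltrD => //; apply: ltrD; first by rewrite distrC.
exact: le_lt_trans qq' ke.
Unshelve. all: by end_near. Qed.

Lemma measurable_derivable i (f : F) : continuous f ->
  measurable [set x | derivable f x (e_ i)].
Proof.
move=> cf; rewrite derivable_osc//; apply: bigcap_measurable => // k _.
by apply: bigcup_measurable => m _; exact: measurable_dquot_osc_le.
Qed.

Lemma measurable_pderiv i (f : F) : continuous f -> measurable_fun setT (pderiv i f).
Proof.
move=> cf; have mE := measurable_derivable i cf.
set E := [set x | _] in mE; rewrite -(setUv E).
apply/measurable_funU => //; first exact: measurableC.
split; last first.
  apply: (eq_measurable_fun (cst (point : R))); last exact: measurable_cst.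
  move=> x; rewrite inE => ndx; rewrite /pderiv /derive dquotE.
  by apply/esym/dvgP; exact: ndx.
apply: (@measurable_fun_cvg _ _ _ _ (fun m x => dquot i f m.+1%:R^-1 x)).
  move=> m; apply: (measurable_funS measurableT) => //.
  by apply: continuous_measurable_rV; exact: continuous_dquot.
move=> x Ex; have : dquot i f ^~ x @ 0^' --> pderiv i f x by exact: Ex.
apply: cvg_comp => A [r /= r0 rA].
have [m mr] := exists_invS_lt r0.
exists m => // k /= mk; apply: rA => /=.
  rewrite sub0r normrN ger0_norm ?invr_ge0//.
  by apply: le_lt_trans mr; rewrite lef_pV2 ?posrE// ler_nat ltnS.
by rewrite invr_eq0 pnatr_eq0.
Qed.

(** On each line parallel to the axis the exceptional set is null by the
one-variable statement. *)
Lemma lipschitz_ae_pderivable i (f : F) : lipschitz f ->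
  {ae leb, forall x, derivable f x (e_ i)}.
Proof.
move=> lf; have cf := lipschitz_continuous lf.
have mE := measurableC (measurable_derivable i cf).
exists (~` [set x | derivable f x (e_ i)]); split => //.
apply: (@null_of_null_lines _ _ i) => // x.
have [L L0 fL] := (lipschitzP f).1 lf.
pose phi (t : R) := f (x + t *: e_ i).
have phiL s t : `|phi s - phi t| <= L * `|s - t|.
  apply: le_trans (fL _ _) _; rewrite ler_wpM2l//.
  rewrite opprD addrACA subrr add0r -scalerBl normrZ ler_piMr//.
  exact: norm_delta_le1.
have mline : measurable_fun setT (fun t : R => x + t *: e_ i).
  apply: measurable_fun_rV => j; under eq_fun do rewrite !mxE.
  by apply: measurable_funD; [exact: measurable_cst|exact: mulrr_measurable].
have [Z [mZ Z0 subZ]] := lipschitz_ae_derivable phiL.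
apply: (subset_measure0 _ mZ _ Z0).
  by rewrite -[X in measurable X]setTI; exact: mline.
move=> t /= ndt; apply: subZ => /= dt; apply: ndt.
have E : (fun h : R => h^-1 *: ((f \o shift (x + t *: e_ i)) (h *: e_ i)
      - f (x + t *: e_ i)) : R^o)
    = (fun h : R => h^-1 *: ((phi \o shift t) (h *: 1) - phi t) : R^o).
  apply/funext => h; congr (_ *: (_ - _)).
  by rewrite /= /phi scalerDl [h *: 1]mulr1 addrCA.
by rewrite /derivable E.
Qed.

End lipschitz_partial_derivatives.

(** * Exhaustion by compact sets and compactly supported Lipschitz functions *)

Section exhaustion.
Context {R : realType} {n : nat}.
Local Notation Rn := 'rV[R]_n.
Local Notation F := (Rn -> R^o).
Local Notation leb := (@lebesgue_rV R n).
Variable Omega : set Rn.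

(** The points at distance at least [1 / (k + 1)] from the complement of [Omega]
inside a ball of radius [k]. *)
Definition exhaust (k : nat) : set Rn :=
  [set x | `|x| <= k%:R /\ ball x k.+1%:R^-1 `<=` Omega].

Lemma exhaust_sub k : exhaust k `<=` Omega.
Proof. by move=> x [_]; apply; apply: ballxx; rewrite invr_gt0. Qed.

Lemma exhaust_compact k : compact (exhaust k).
Proof.
apply: bounded_closed_compact.
  exists k%:R; split; first exact: num_real.
  by move=> M kM x [xk _]; apply: (le_trans xk); exact: ltW.
rewrite (_ : exhaust k = [set x | `|x| <= k%:R] `&`
  [set x | ball x k.+1%:R^-1 `<=` Omega])//.
apply: closedI.
  apply: (preimage_closed _ (@closed_le R k%:R)) => x _; exact: norm_continuous.
move=> x clx z xz.
have [r r0 rP] : exists2 r : R, 0 < r & forall y : Rn, ball x r y -> ball y k.+1%:R^-1 z.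
  exists (k.+1%:R^-1 - `|x - z|); first by move: xz; rewrite -ball_normE /= subr_gt0.
  move=> y; rewrite -ball_normE /= => xy.
  rewrite (_ : y - z = (x - z) - (x - y)); last by rewrite [RHS]addrC opprB addrA subrK.
  by rewrite (le_lt_trans (ler_normB _ _))// -ltrBrDl.
have [y [/= yO xy]] := clx _ (nbhsx_ballx x r r0).
exact/yO/rP.
Qed.

Hypothesis oOmega : open Omega.

(** Near a point of [Omega] all the sets with large index contain a fixed
neighbourhood; compactness makes the index uniform. *)
Lemma exhaust_absorb K : compact K -> K `<=` Omega -> exists k, K `<=` exhaust k.
Proof.
move=> /compact_near_coveringP cK KO.
have H x : K x -> \forall y \near x & k \near \oo, exhaust k y.
  move=> Kx.
  have [r /= r0 rO] : nbhs_ball x Omega.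
    by apply/nbhs_ballP; apply: open_nbhs_nbhs; split => //; exact: KO.
  have r2 : 0 < r / 2 by rewrite divr_gt0.
  have [m mr] := exists_invS_lt r2.
  exists (ball x (r / 2), [set k | (maxn m (Num.bound (`|x| + r / 2)) <= k)%N]) => /=.
    split; first exact: nbhsx_ballx.
    exact: nbhs_infty_ge.
  move=> [y k] /= [xy]; rewrite geq_max => /andP[mk bk].
  have xy' : `|x - y| < r / 2 by move: xy; rewrite -ball_normE.
  split.
    apply: (@le_trans _ _ (Num.bound (`|x| + r / 2))%:R); last by rewrite ler_nat.
    apply/ltW/(le_lt_trans _ (archi_boundP _)); last by rewrite addr_ge0// ltW.
    rewrite -[y](subrK x) addrC (le_trans (ler_normD _ _))// lerD2l distrC ltW//.
  move=> z yz; apply: rO; rewrite -ball_normE /=.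
  have yz' : `|y - z| < r / 2.
    move: yz; rewrite -ball_normE /= => /lt_le_trans; apply.
    by apply/ltW; apply: le_lt_trans mr; rewrite lef_pV2 ?posrE// ler_nat.
  rewrite (splitr r) -(subrK y x) -addrA (le_lt_trans (ler_normD _ _))//.
  exact: ltrD.
have [k _ kK] := cK nat \oo (fun k y => exhaust k y) _ H.
by exists k; exact: (kK k (leqnn k)).
Qed.

Lemma exhaust_cover x : Omega x -> exists k, exhaust k x.
Proof.
move=> Ox; have [k] : exists k, [set x] `<=` exhaust k.
  by apply: exhaust_absorb => [|y ->//]; exact: compact_set1.
by move=> /(_ x erefl) xk; exists k.
Qed.

Lemma bigcup_exhaust : \bigcup_k exhaust k = Omega.
Proof.
apply/seteqP; split=> [x [k _ /exhaust_sub]//|x /exhaust_cover[k kx]].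
by exists k.
Qed.

Lemma measurable_exhaust k : measurable (exhaust k).
Proof. by apply: compact_measurable_rV; exact: exhaust_compact. Qed.

Lemma L1loc_measurable (f : Rn -> \bar R) : L1loc Omega f -> measurable_fun Omega f.
Proof.
move=> f1; rewrite -bigcup_exhaust; apply/measurable_fun_bigcup => k.
  exact: measurable_exhaust.
have := f1 _ (@exhaust_compact k) (@exhaust_sub k).
exact: measurable_int.
Qed.

End exhaustion.

Lemma normr_max0B {R : realType} (p q : R) :
  `|Num.max 0 p - Num.max 0 q| <= `|p - q|.
Proof.
by case: (leP 0 p) => p0; case: (leP 0 q) => q0; case: (ger0P (p - q)) => pq;
  rewrite ?ler_norml; lra.
Qed.

Section W1infc_theory.
Context {R : realType} {n : nat}.
Local Notation Rn := 'rV[R]_n.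
Local Notation F := (Rn -> R^o).
Local Notation leb := (@lebesgue_rV R n).
Local Notation e_ i := (delta_mx ord0 i : Rn).
Variable Omega : set Rn.

Lemma W1infc_lip u : W1infc Omega u -> lipschitz u. Proof. by case. Qed.

Lemma W1infc_continuous u : W1infc Omega u -> continuous u.
Proof. by move=> /W1infc_lip; exact: lipschitz_continuous. Qed.

Lemma W1infc_measurable u : W1infc Omega u -> measurable_fun setT u.
Proof. by move=> /W1infc_continuous; exact: continuous_measurable_rV. Qed.

Lemma notin_supp (u : F) x : ~ supp u x -> u x = 0.
Proof. by move=> nx; apply: contrapT => /eqP ux; apply: nx; exact: subset_closure. Qed.

Lemma pderiv_notin_supp i (u : F) x : ~ supp u x -> pderiv i u x = 0.
Proof.
move=> nx; rewrite /pderiv (@near_eq_derive _ _ _ _ (cst 0)) ?derive_cst//.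
have : nbhs x (~` supp u).
  by apply: open_nbhs_nbhs; split => //; apply: closed_openC; exact: closed_closure.
by apply: filterS => y /notin_supp.
Qed.

Lemma W1infc_bounded u : W1infc Omega u -> exists2 M : R, 0 <= M & forall x, `|u x| <= M.
Proof.
move=> uW; have [_ cu _] := uW.
have : compact (u @` supp u).
  by apply: continuous_compact => //; apply: continuous_subspaceT; exact: W1infc_continuous uW.
move=> /compact_bounded/pinfty_ex_gt0[M M0 uM].
exists M; first exact: ltW.
move=> x; have [xu|/notin_supp ->] := pselect (supp u x).
  by apply: uM; exists x.
by rewrite normr0 ltW.
Qed.

(** The support of [f] lies in the union of the supports of [u] and [v]. *)
Lemma W1infc_sub (f : F) u v : W1infc Omega u -> W1infc Omega v -> lipschitz f ->
  (forall x, u x = 0 -> v x = 0 -> f x = 0) -> W1infc Omega f.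
Proof.
move=> [_ cu uO] [_ cv vO] lf f0.
have sub : supp f `<=` supp u `|` supp v.
  have -> : supp u `|` supp v = closure (supp u `|` supp v).
    by apply/closure_id; apply: closedU; exact: closed_closure.
  apply: closureS => x /= fx; have [ux|ux] := eqVneq (u x) 0.
    have [vx|vx] := eqVneq (v x) 0; first by rewrite f0 ?eqxx in fx.
    by right; exact: subset_closure.
  by left; exact: subset_closure.
split => //; last by apply: (subset_trans sub) => x [/uO|/vO].
apply: (subclosed_compact _ (compactU cu cv) sub); exact: closed_closure.
Qed.

Lemma W1infc_lin (a b : R) u v : W1infc Omega u -> W1infc Omega v ->
  W1infc Omega (fun x => a * u x + b * v x : R^o).
Proof.
move=> uW vW; apply: (W1infc_sub uW vW); last first.
  by move=> x -> ->; rewrite !mulr0 addr0.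
have [/lipschitzP[L L0 uL] _ _] := uW.
have [/lipschitzP[L' L'0 vL] _ _] := vW.
apply/lipschitzP; exists (`|a| * L + `|b| * L').
  by rewrite addr_ge0// mulr_ge0.
move=> x y.
rewrite (_ : a * u x + b * v x - _ = a * (u x - u y) + b * (v x - v y)); last by ring.
rewrite mulrDl -!mulrA (le_trans (ler_normD _ _))// !normrM.
by rewrite lerD// ler_wpM2l.
Qed.

Lemma W1infcZ (a : R) u : W1infc Omega u -> W1infc Omega (a *: u).
Proof.
move=> uW; have := W1infc_lin a 0 uW uW; congr (W1infc _ _).
by apply/funext => x; rewrite mul0r addr0.
Qed.

Lemma W1infcD u v : W1infc Omega u -> W1infc Omega v -> W1infc Omega (u + v).
Proof.
move=> uW vW; have := W1infc_lin 1 1 uW vW; congr (W1infc _ _).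
by apply/funext => x; rewrite !mul1r.
Qed.

Lemma W1infcB u v : W1infc Omega u -> W1infc Omega v -> W1infc Omega (u - v).
Proof.
move=> uW vW; have := W1infc_lin 1 (-1) uW vW; congr (W1infc _ _).
by apply/funext => x; rewrite mulN1r !mul1r.
Qed.

Lemma W1infc0 : W1infc Omega (0 : F).
Proof.
have -> : (0 : F) = cst 0 by [].
have s0 : supp (cst 0 : F) = set0.
  rewrite /supp (_ : mkset _ = set0) ?closure0//.
  by apply/seteqP; split => // x /=; rewrite eqxx.
split; rewrite ?s0//; last exact: compact0.
apply/lipschitzP; exists 0 => // x y; by rewrite subrr normr0 mul0r.
Qed.

(** A compact set lies in some [exhaust Omega k], so a single radius serves for
tent functions centred at all its points; a finite sum of them does it. *)
Lemma cutoff K : open Omega -> compact K -> K `<=` Omega ->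
  exists u : F, [/\ W1infc Omega u, forall x, 0 <= u x & forall x, K x -> 1 <= u x].
Proof.
move=> oO cK KO; have [k Kk] := exhaust_absorb oO cK KO.
pose r : R := k.+1%:R^-1 / 2.
have r0 : 0 < r by rewrite divr_gt0.
have r20 : 0 <= 2 / r by rewrite divr_ge0// ltW.
pose bump (y x : Rn) : R := Num.max 0 (2 - 2 / r * `|x - y|).
have bump0 y x : 0 <= bump y x by rewrite le_max lexx.
have bumpW y : K y -> W1infc Omega (bump y : F).
  move=> Ky.
  have sub : supp (bump y : F) `<=` [set x | `|x - y| <= r].
    have -> : [set x : Rn | `|x - y| <= r] = closure [set x : Rn | `|x - y| <= r].
      apply/closure_id.
      have cn : continuous (fun x : Rn => `|x - y|).
        move=> x; have Fx := nbhs_filter x.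
        by apply: cvg_norm; apply: (@cvgB _ _ _ _ Fx); [exact: cvg_id|exact: cvg_cst].
      exact: (preimage_closed (in1W cn) (@closed_le R r)).
    apply: closureS => x /=; apply: contraNle => xr.
    rewrite /bump; apply/eqP/max_idPl.
    by rewrite subr_le0 mulrAC ler_pdivlMr// ler_pM2l// ltW.
  split.
  - apply/lipschitzP; exists (2 / r); first by rewrite divr_ge0 ?ltW.
    move=> x z; rewrite /bump.
    apply: (le_trans (normr_max0B _ _)).
    rewrite (_ : _ - _ = 2 / r * (`|z - y| - `|x - y|)); last by ring.
    rewrite normrM (ger0_norm r20) ler_wpM2l//.
    rewrite (le_trans (ler_dist_dist _ _))// distrC.
    by rewrite opprB addrA subrK.
  - apply: bounded_closed_compact; last exact: closed_closure.
    exists (`|y| + r); split; first exact: num_real.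
    move=> M yM x /sub /= xy; apply/ltW/(le_lt_trans _ yM).
    by rewrite -[x](subrK y) addrC (le_trans (ler_normD _ _))// lerD2l.
  - move=> x /sub /= xy; have [_] := Kk _ Ky; apply.
    rewrite -ball_normE /= distrC (le_lt_trans xy)// /r.
    by rewrite ltr_pdivrMr// ltr_pMr ?invr_gt0// ltr1n.
have [D DK KD] : finite_subset_cover K (fun y => ball y (r / 2)) K.
  move: cK; rewrite compact_cover; apply.
    by move=> y _; apply: ball_open; rewrite divr_gt0.
  by move=> y Ky; exists y => //; apply: ballxx; rewrite divr_gt0.
pose s : seq Rn := finmap.enum_fset D.
exists (fun x => \sum_(y <- s) bump y x); split.
- have : {subset s <= K} by exact: DK.
  elim: s => [_|y s IH ys].
    rewrite (_ : (fun x => _) = 0); first exact: W1infc0.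
    by apply/funext => x; rewrite big_nil.
  rewrite (_ : (fun x => _) = (bump y : F) + (fun x => \sum_(y <- s) bump y x)).
    apply: W1infcD; first by apply: bumpW; apply/set_mem/ys; rewrite inE eqxx.
    by apply: IH => z zs; apply: ys; rewrite inE zs orbT.
  by apply/funext => x; rewrite big_cons.
- by move=> x; apply: sumr_ge0.
- move=> x /KD[y /= yD]; rewrite -ball_normE /= => xy.
  rewrite (big_rem y)//= -[1]addr0 lerD ?sumr_ge0//.
  rewrite /bump le_max; apply/orP; right.
  rewrite lerBrDr -lerBrDl (_ : 2 - 1 = 1); last by ring.
  by rewrite mulrAC ler_pdivrMr// mul1r -ler_pdivlMl// mulrC distrC ltW.
Qed.

End W1infc_theory.

(** * The energy as a bilinear form *)

Section integrability.
Context {R : realType} {n : nat}.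
Local Notation Rn := 'rV[R]_n.
Local Notation F := (Rn -> R^o).
Local Notation leb := (@lebesgue_rV R n).
Variable Omega : set Rn.
Hypothesis oOmega : open Omega.

Lemma integrable_of_compact (K : set Rn) (f : Rn -> R) : compact K -> K `<=` Omega ->
  (forall x, ~ K x -> f x = 0) -> leb.-integrable K (EFin \o f) ->
  leb.-integrable Omega (EFin \o f).
Proof.
move=> cK KO f0 fK.
have mO := open_measurable_rV oOmega; have mK := compact_measurable_rV cK.
apply/(integrable_mkcond _ mO); move/(integrable_mkcond _ mK) : fK.
apply: eq_integrable => // x _; rewrite !patchE.
have [xK|xK] := boolP (x \in K); first by rewrite mem_set//; apply/KO/set_mem.
by case: ifP => // _; rewrite /= f0//; move: xK; rewrite notin_setE.
Qed.

(** Every term of the energy is a locally integrable function, the potential or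
the constant 1, times a bounded function of compact support. *)
Lemma L1loc_mul_integrable (V g : Rn -> R) K M : L1loc Omega (EFin \o V) ->
  compact K -> K `<=` Omega -> measurable_fun setT g ->
  (forall x, `|g x| <= M) -> (forall x, ~ K x -> g x = 0) ->
  leb.-integrable Omega (EFin \o (fun x => V x * g x)).
Proof.
move=> V1 cK KO mg gM g0.
apply: (integrable_of_compact cK KO); first by move=> x /g0 ->; rewrite mulr0.
have mK := compact_measurable_rV cK.
have VK := V1 K cK KO.
have mV : measurable_fun K V by apply/measurable_EFinP; exact: measurable_int VK.
apply: (le_integrable mK _ _ (integrableZl mK M (integrable_abse VK))) => /=.
  apply/measurable_EFinP; apply: measurable_funM => //.
  exact: measurable_funTS.
move=> x _; rewrite lee_fin normrM mulrC normrM normr_id.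
by rewrite ler_pM// (le_trans (gM x))// ler_norm.
Qed.

Lemma L1loc1 : L1loc Omega (EFin \o (fun=> 1 : R)).
Proof.
move=> K cK KO; have mK := compact_measurable_rV cK.
apply/integrableP; split; first exact/measurable_EFinP/measurable_cst.
under eq_integral do rewrite /= normr1.
rewrite integral_cst// mul1e; exact: compact_finite_measure_rV.
Qed.

Lemma bounded_integrable (g : Rn -> R) K M :
  compact K -> K `<=` Omega -> measurable_fun setT g ->
  (forall x, `|g x| <= M) -> (forall x, ~ K x -> g x = 0) ->
  leb.-integrable Omega (EFin \o g).
Proof.
move=> cK KO mg gM g0.
have := L1loc_mul_integrable L1loc1 cK KO mg gM g0.
by apply: eq_integrable => [|x _ /=]; rewrite ?mul1r//; exact: open_measurable_rV.
Qed.

End integrability.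

Section energy_form.
Context {R : realType} {n : nat}.
Local Notation Rn := 'rV[R]_n.
Local Notation F := (Rn -> R^o).
Local Notation leb := (@lebesgue_rV R n).
Variables (Omega : set Rn) (V : Rn -> R).
Hypothesis oOmega : open Omega.
Hypothesis V1 : L1loc Omega (fun x => (V x)%:E).

Definition gradM (u v : F) (x : Rn) : R := \sum_(i < n) pderiv i u x * pderiv i v x.

Definition Qform (u v : F) : R :=
  \int[leb]_(x in Omega) (gradM u v x + V x * (u x * v x)).

Lemma measurable_gradM u v : W1infc Omega u -> W1infc Omega v ->
  measurable_fun setT (gradM u v).
Proof.
move=> uW vW; apply: measurable_sum => i.
apply: measurable_funM; apply: measurable_pderiv.
  exact: W1infc_continuous uW.
exact: W1infc_continuous vW.
Qed.

Lemma integrable_gradM u v : W1infc Omega u -> W1infc Omega v ->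
  leb.-integrable Omega (EFin \o gradM u v).
Proof.
move=> uW vW; have mg := measurable_gradM uW vW.
have [/lipschitzP[L L0 uL] cu uO] := uW.
have [/lipschitzP[L' L'0 vL] _ _] := vW.
apply: (bounded_integrable oOmega (M := \sum_(i < n) L * L') cu uO mg).
  move=> x; apply: le_trans (ler_norm_sum _ _ _) _; apply: ler_sum => i _.
  by rewrite normrM ler_pM//; apply: pderiv_bound.
by move=> x xu; rewrite /gradM big1// => i _; rewrite pderiv_notin_supp ?mul0r.
Qed.

Lemma integrable_potential u v : W1infc Omega u -> W1infc Omega v ->
  leb.-integrable Omega (EFin \o (fun x => V x * (u x * v x))).
Proof.
move=> uW vW; have [_ cu uO] := uW.
have [M M0 uM] := W1infc_bounded uW; have [M' M'0 vM] := W1infc_bounded vW.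
apply: (L1loc_mul_integrable oOmega (M := M * M') V1 cu uO).
- by apply: measurable_funM; [exact: W1infc_measurable uW|exact: W1infc_measurable vW].
- by move=> x; rewrite normrM ler_pM.
- by move=> x /notin_supp ->; rewrite mul0r.
Qed.

Lemma integrable_Qform u v : W1infc Omega u -> W1infc Omega v ->
  leb.-integrable Omega (EFin \o (fun x => gradM u v x + V x * (u x * v x))).
Proof.
move=> uW vW.
have mO := open_measurable_rV oOmega.
have := integrableD mO (integrable_gradM uW vW) (integrable_potential uW vW).
by apply: eq_integrable.
Qed.

Lemma Q_Qform u : Q Omega V u = Qform u u.
Proof. by apply: eq_Rintegral => x _; rewrite expr2. Qed.

Lemma ae_pderivable (u : F) : lipschitz u ->
  {ae leb, forall x, forall i : 'I_n, derivable u x (delta_mx ord0 i)}.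
Proof. by move=> lu; apply: filter_forall => i; exact: lipschitz_ae_pderivable. Qed.

Lemma ae_eq_Rintegral (f g : Rn -> R) :
  leb.-integrable Omega (EFin \o f) -> leb.-integrable Omega (EFin \o g) ->
  {ae leb, forall x, Omega x -> f x = g x} ->
  \int[leb]_(x in Omega) f x = \int[leb]_(x in Omega) g x.
Proof.
move=> fi gi fg; rewrite /Rintegral; congr fine.
apply: (ae_eq_integral (EFin \o g)).
- exact: open_measurable_rV.
- exact: measurable_int fi.
- exact: measurable_int gi.
- by apply: filterS fg => x /[apply] /= ->.
Qed.

Lemma Rintegral_ae_le (f g : Rn -> R) :
  leb.-integrable Omega (EFin \o f) -> leb.-integrable Omega (EFin \o g) ->
  {ae leb, forall x, Omega x -> f x <= g x} ->
  \int[leb]_(x in Omega) f x <= \int[leb]_(x in Omega) g x.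
Proof.
move=> fi gi fg; have mO := open_measurable_rV oOmega.
have mi : leb.-integrable Omega (EFin \o (fun x => Num.min (f x) (g x))).
  apply: (le_integrable mO _ _
    (integrableD mO (integrable_abse fi) (integrable_abse gi))).
    apply/measurable_EFinP/measurable_minr.
      by apply/measurable_EFinP; exact: measurable_int fi.
    by apply/measurable_EFinP; exact: measurable_int gi.
  move=> x _ /=; rewrite lee_fin [leRHS]ger0_norm ?addr_ge0//.
  by case: (leP (f x) (g x)) => _; rewrite ?lerDl ?lerDr.
rewrite (ae_eq_Rintegral fi mi); last first.
  by apply: filterS fg => x fg Ox; rewrite min_l ?fg.
by apply: le_Rintegral => // x _; rewrite ge_min lexx orbT.
Qed.

(** The partial derivatives are additive only where both functions are
derivable, that is, almost everywhere. *)
Lemma Q_line u v (t : R) : W1infc Omega u -> W1infc Omega v ->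
  Q Omega V (u + t *: v) = Q Omega V u + 2 * t * Qform u v + t ^+ 2 * Q Omega V v.
Proof.
move=> uW vW; have mO := open_measurable_rV oOmega.
have wW : W1infc Omega (u + t *: v) by apply: W1infcD => //; exact: W1infcZ.
have Zi (c : R) f : leb.-integrable Omega (EFin \o f) ->
    leb.-integrable Omega (EFin \o (fun x => c * f x)).
  by move=> fi; have := integrableZl mO c fi; apply: eq_integrable.
have Di f g : leb.-integrable Omega (EFin \o f) -> leb.-integrable Omega (EFin \o g) ->
    leb.-integrable Omega (EFin \o (fun x => f x + g x)).
  by move=> fi gi; have := integrableD mO fi gi; apply: eq_integrable.
have iuu := integrable_Qform uW uW.
have iuv := Zi (2 * t) _ (integrable_Qform uW vW).
have ivv := Zi (t ^+ 2) _ (integrable_Qform vW vW).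
rewrite !Q_Qform /Qform -!RintegralZl//; [|exact: integrable_Qform..].
rewrite -RintegralD// -RintegralD//; last exact: Di.
apply: ae_eq_Rintegral; [exact: integrable_Qform|exact: (Di _ _ (Di _ _ iuu iuv) ivv)|].
apply: filterS2 (ae_pderivable (W1infc_lip uW)) (ae_pderivable (W1infc_lip vW)).
move=> x du dv _.
have pE i : pderiv i (u + t *: v) x = pderiv i u x + t * pderiv i v x.
  rewrite /pderiv deriveD; [|exact: du|apply: derivableZ; exact: dv].
  by rewrite deriveZ; last exact: dv.
rewrite /gradM (eq_bigr _ (fun i _ => congr2 *%R (pE i) (pE i))).
rewrite (_ : \sum_(i < n) _ = \sum_(i < n) (pderiv i u x * pderiv i u x) +
  2 * t * (\sum_(i < n) (pderiv i u x * pderiv i v x)) +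
  t ^+ 2 * (\sum_(i < n) (pderiv i v x * pderiv i v x))).
  have -> : (u + t *: v) x = u x + t * v x by [].
  set A := \sum_(i < n) _; set B := \sum_(i < n) _; set C := \sum_(i < n) _. ring.
rewrite !mulr_sumr -!big_split/=; apply: eq_bigr => i _; ring.
Qed.

End energy_form.

(** * A positive source dominated by the energy *)

Section weight.
Context {R : realType} {n : nat}.
Local Notation Rn := 'rV[R]_n.
Local Notation F := (Rn -> R^o).
Local Notation leb := (@lebesgue_rV R n).
Variables (Omega : set Rn) (V : Rn -> R).
Hypothesis oOmega : open Omega.
Hypothesis V1 : L1loc Omega (fun x => (V x)%:E).

Lemma QZ (c : R) u : W1infc Omega u -> Q Omega V (c *: u) = c ^+ 2 * Q Omega V u.
Proof.
(* A point of the line through u in the direction of u itself. *)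
move=> uW; have -> : c *: u = u + (c - 1) *: u.
  by rewrite -{2}[u]scale1r -scalerDl addrC subrK.
by rewrite Q_line// -Q_Qform; ring.
Qed.

(** Continuity at 0 and homogeneity.  [u] is rescaled to energy norm less than
[d]; the margin [e] covers the functions of zero energy. *)
Lemma L1_subcritical_bound K : L1_subcritical Omega V -> compact K -> K `<=` Omega ->
  exists2 C : R, 0 <= C & forall u, W1infc Omega u ->
    (\int[leb]_(x in K) `|u x|%:E <= (C * Num.sqrt (Q Omega V u))%:E)%E.
Proof.
move=> [_ [_ emb]] cK KO.
have [|d d0 dP] := emb (snorm (L1 K)) _ (0 : F) (W1infc0 Omega) 1 ltr01.
  by exists K.
have mK := compact_measurable_rV cK.
exists (2 / d); first by rewrite divr_ge0// ltW.
move=> u uW; apply/lee_addgt0Pr => e e0.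
pose s := Num.sqrt (Q Omega V u); have s0 : 0 <= s by exact: sqrtr_ge0.
pose c := d / (2 * s + d * e).
have den0 : 0 < 2 * s + d * e by rewrite ltr_wpDl ?mulr_ge0 ?mulr_gt0.
have c0 : 0 < c by rewrite divr_gt0.
have := dP _ (W1infcZ c uW); rewrite subr0 /= lte_fin.
have -> : Num.sqrt (Q Omega V (c *: u)) = c * s.
  by rewrite QZ// sqrtrM ?sqr_ge0// sqrtr_sqr gtr0_norm.
have cs : c * s < d.
  rewrite /c mulrAC ltr_pdivrMr// ltr_pM2l//.
  by rewrite -subr_gt0 (_ : _ - _ = s + d * e) ?ltr_wpDl ?mulr_gt0//; ring.
move=> /(_ cs).
under eq_integral do rewrite [(c *: u) _]/(c * u _) normrM (gtr0_norm c0) EFinM.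
rewrite ge0_integralZl_EFin//; last 2 first.
  by apply/measurable_EFinP; apply: measurableT_comp => //;
    exact: measurable_funTS (W1infc_measurable uW).
  exact: ltW.
rewrite -lte_pdivlMl// mule1 => /ltW/le_trans; apply.
rewrite -EFinD lee_fin /c invf_div le_eqVlt; apply/orP; left; apply/eqP.
by rewrite -/s; field; rewrite gt_eqF.
Qed.

(** Sum of the indicators of an exhaustion, with coefficients so small that the
bounds on the pieces add up to at most the energy norm. *)
Lemma weight_exists : L1_subcritical Omega V -> exists f : Rn -> R,
  [/\ measurable_fun setT f, forall x, 0 <= f x <= 1,
    forall K, compact K -> K `<=` Omega ->
      exists2 c : R, 0 < c & forall x, K x -> c <= f x &
    forall u, W1infc Omega u ->
      (\int[leb]_(x in Omega) (f x * `|u x|)%:E <= (Num.sqrt (Q Omega V u))%:E)%E].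
Proof.
move=> L1s.
have /choice[C CP] : forall k : nat, exists C : R, 0 <= C /\ forall u, W1infc Omega u ->
    (\int[leb]_(x in exhaust Omega k) `|u x|%:E <= (C * Num.sqrt (Q Omega V u))%:E)%E.
  move=> k; have [C C0 CP] :=
    L1_subcritical_bound L1s (@exhaust_compact _ _ Omega k) (@exhaust_sub _ _ Omega k).
  by exists C.
pose c (k : nat) : R := 1 / (2 ^ k.+1)%:R / (C k + 1).
have C1 k : 0 < C k + 1 by have [? _] := CP k; lra.
have c0 k : 0 < c k by rewrite !divr_gt0// ltr0n expn_gt0.
have cle k : c k <= 1 / (2 ^ k.+1)%:R.
  rewrite /c ler_pdivrMr// ler_peMr ?divr_ge0//; have [? _] := CP k; lra.
have cC k : c k * C k <= 1 / (2 ^ k.+1)%:R.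
  rewrite /c mulrAC -mulrA ler_piMr ?divr_ge0// ler_pdivrMr// mul1r; lra.
pose g (k : nat) (x : Rn) : \bar R := (c k * \1_(exhaust Omega k) x)%:E.
have g0 k x : (0 <= g k x)%E by rewrite lee_fin mulr_ge0//; exact: ltW.
have mg k : measurable_fun setT (g k).
  apply/measurable_EFinP; apply: measurable_funM; first exact: measurable_cst.
  by apply: measurable_indic; exact: measurable_exhaust.
pose fb x : \bar R := (\sum_(k <oo) g k x)%E.
have fb0 x : (0 <= fb x)%E by apply: nneseries_ge0.
have fb1 x : (fb x <= 1)%E.
  apply: le_trans (epsilon_trick0 xpredT (ler01 : 0 <= (1 : R))).
  apply: lee_nneseries => // k _; rewrite lee_fin (le_trans _ (cle k))//.
  by apply: ler_piMr; [exact: ltW|rewrite indicE; case: (_ \in _)].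
have fbfin x : fb x \is a fin_num.
  by rewrite ge0_fin_numE// (le_lt_trans (fb1 x)) ?ltry.
have mfb : measurable_fun setT fb by apply: ge0_emeasurable_sum.
exists (fine \o fb); split.
- exact: measurableT_comp.
- move=> x; rewrite fine_ge0//= -lee_fin fineK//.
- move=> K cK KO; have [k Kk] := exhaust_absorb oOmega cK KO.
  exists (c k) => // x Kx; rewrite -lee_fin fineK//.
  apply: le_trans (nneseries_lim_ge k.+1 _) => //.
  rewrite big_nat_recr//= -[leLHS]add0e leeD ?sume_ge0//.
  by rewrite /g indicE mem_set ?mulr1//; exact: Kk.
- move=> u uW.
  have mO := open_measurable_rV oOmega.
  have mu_ : measurable_fun Omega (fun x => `|u x|%:E).
    apply/measurable_EFinP; apply: measurableT_comp => //.
    exact: measurable_funTS (W1infc_measurable uW).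
  rewrite (eq_integral (fun x => \sum_(k <oo) `|u x|%:E * g k x)%E); last first.
    by move=> x _; rewrite nneseriesZl// EFinM fineK// muleC.
  rewrite integral_nneseries//; last 2 first.
  + move=> k; apply: emeasurable_funM => //; exact: measurable_funTS.
  + by move=> k x _; rewrite mule_ge0.
  pose s := Num.sqrt (Q Omega V u); have s0 : 0 <= s by exact: sqrtr_ge0.
  apply: le_trans (epsilon_trick0 xpredT s0).
  apply: lee_nneseries => [k _ _|k _].
    by apply: integral_ge0 => x _; rewrite mule_ge0.
  have [Ck0 CkP] := CP k.
  rewrite (eq_integral
    (fun x => (c k)%:E * ((fun y => `|u y|%:E) \_ (exhaust Omega k)) x)%E);
    last first.
    move=> x _; rewrite /g patchE indicE muleC; case: ifP => _; first by rewrite mulr1.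
    by rewrite mulr0 mul0e mule0.
  rewrite ge0_integralZl_EFin//; last 3 first.
  + by move=> x _; rewrite patchE; case: ifP.
  + apply/(measurable_restrict _ (measurable_exhaust Omega k) mO).
    by apply: measurable_funS mu_ => //; exact: subIsetl.
  + exact: ltW.
  rewrite -integral_mkcondr setIidr; last exact: exhaust_sub.
  apply: (@le_trans _ _ ((c k)%:E * (C k * s)%:E)%E).
    by apply: lee_wpmul2l; [rewrite lee_fin ltW|exact: CkP].
  rewrite -EFinM lee_fin mulrA (_ : s / _ = (1 / (2 ^ k.+1)%:R) * s); last first.
    by rewrite mul1r mulrC.
  by rewrite ler_wpM2r.
Qed.

End weight.

(** * Almost minimizers of the energy with a source *)

Section minimization.
Context {R : realType} {n : nat}.
Local Notation Rn := 'rV[R]_n.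
Local Notation F := (Rn -> R^o).
Local Notation leb := (@lebesgue_rV R n).
Variables (Omega : set Rn) (V : Rn -> R).
Hypothesis oOmega : open Omega.
Hypothesis V1 : L1loc Omega (fun x => (V x)%:E).
Hypothesis Q0 : Q_nonneg Omega V.
Variable f : Rn -> R.
Hypothesis mf : measurable_fun setT f.
Hypothesis f01 : forall x, 0 <= f x <= 1.
Hypothesis fQ : forall u, W1infc Omega u ->
  (\int[leb]_(x in Omega) (f x * `|u x|)%:E <= (Num.sqrt (Q Omega V u))%:E)%E.

Definition source (u : F) : R := \int[leb]_(x in Omega) (f x * u x).

Definition energy (u : F) : R := Q Omega V u / 2 - source u.

(** Competitors are restricted to the cone of nonnegative functions, so that
nonnegativity of [u] costs nothing. *)
Definition near_minimizer (e : R) (u : F) : Prop :=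
  [/\ W1infc Omega u, forall x, 0 <= u x &
    forall v, W1infc Omega v -> (forall x, 0 <= v x) -> energy u <= energy v + e].

Lemma integrable_source u : W1infc Omega u ->
  leb.-integrable Omega (EFin \o (fun x => f x * u x)).
Proof.
move=> uW; have [_ cu uO] := uW; have [M M0 uM] := W1infc_bounded uW.
apply: (bounded_integrable oOmega (M := M) cu uO).
- by apply: measurable_funM => //; exact: W1infc_measurable uW.
- move=> x; have /andP[f0 f1] := f01 x.
  by rewrite normrM ger0_norm// (le_trans _ (uM x))// ler_piMl.
- by move=> x /notin_supp ->; rewrite mulr0.
Qed.

Lemma source_line u v t : W1infc Omega u -> W1infc Omega v ->
  source (u + t *: v) = source u + t * source v.
Proof.
move=> uW vW; have mO := open_measurable_rV oOmega.
have iu := integrable_source uW; have iv := integrable_source vW.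
have itv : leb.-integrable Omega (EFin \o (fun x => t * (f x * v x))).
  by have := integrableZl mO t iv; apply: eq_integrable.
rewrite /source -RintegralZl// -RintegralD//; apply: eq_Rintegral => x _.
have -> : (u + t *: v) x = u x + t * v x by [].
by ring.
Qed.

Lemma source_le u : W1infc Omega u -> source u <= Num.sqrt (Q Omega V u).
Proof.
move=> uW; have mO := open_measurable_rV oOmega.
rewrite -lee_fin; apply: le_trans (fQ uW).
have iu := integrable_source uW.
rewrite /source /Rintegral fineK; last exact: integrable_fin_num.
apply: le_integral => //.
  have := integrable_abse iu; apply: eq_integrable => // x _ /=.
  by have /andP[f0 f1] := f01 x; rewrite normrM ger0_norm.
by move=> x _; rewrite lee_fin ler_wpM2l ?ler_norm//; have /andP[] := f01 x.
Qed.

Lemma energy_line u v t : W1infc Omega u -> W1infc Omega v ->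
  energy (u + t *: v) = energy u + t * (Qform Omega V u v - source v)
    + t ^+ 2 / 2 * Q Omega V v.
Proof. by move=> uW vW; rewrite /energy Q_line// source_line//; field. Qed.

(** [s ^+ 2 / 2 - s >= - 1 / 2] with [s] the energy norm. *)
Lemma energy_ge u : W1infc Omega u -> - (2^-1) <= energy u.
Proof.
move=> uW; rewrite /energy; have := source_le uW.
have := sqr_sqrtr (Q0 uW); set s := Num.sqrt _ => sE su.
have := sqr_ge0 (s - 1); rewrite sqrrB1 sE; lra.
Qed.

Lemma near_minimizer_exists e : 0 < e -> exists u, near_minimizer e u.
Proof.
move=> e0.
pose S := [set energy u | u in [set u | W1infc Omega u /\ forall x, 0 <= u x]].
have S0 : has_inf S.
  split; first by exists (energy 0), 0 => //; split => //; exact: W1infc0.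
  by exists (- (2^-1)) => _ [u [uW _] <-]; exact: energy_ge.
have [_ [u [uW u0] <-] ule] := inf_adherent e0 S0.
exists u; split => // v vW v0; apply/ltW/(lt_le_trans ule); rewrite lerD2r.
by apply: ge_inf; [case: S0|exists v].
Qed.

(** One-sided Euler-Lagrange inequality: [u + t *: phi] stays in the cone. *)
Lemma near_minimizer_variation e u phi t : near_minimizer e u ->
  W1infc Omega phi -> (forall x, 0 <= phi x) -> 0 < t ->
  source phi <= Qform Omega V u phi + t / 2 * Q Omega V phi + e / t.
Proof.
move=> [uW u0 umin] pW p0 t0.
have : energy u <= energy (u + t *: phi) + e.
  apply: umin => [|x]; first by apply: W1infcD => //; exact: W1infcZ.
  by rewrite addr_ge0// mulr_ge0// ltW.
rewrite energy_line// -[source phi <= _](ler_pM2l t0).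
set S := source phi; set B := Qform _ _ _ _; set Qp := Q _ _ _.
have -> : t * (B + t / 2 * Qp + e / t) = t * B + t ^+ 2 / 2 * Qp + e.
  by field; rewrite gt_eqF.
set q := t ^+ 2 / 2 * Qp; rewrite mulrBr; lra.
Qed.

(** The midpoint of [u] and [v] lies in the cone, and by the parallelogram
identity its energy is below the mean of the two by [Q (v - u) / 8]. *)
Lemma near_minimizer_close e e' u v : near_minimizer e u -> near_minimizer e' v ->
  Q Omega V (v - u) <= 4 * (e + e').
Proof.
move=> [uW u0 umin] [vW v0 vmin].
have dW := W1infcB vW uW.
(* The midpoint, written as a point of the line from u to v. *)
pose m := u + 2^-1 *: (v - u).
have mW : W1infc Omega m by apply: W1infcD => //; exact: W1infcZ.
have m0 x : 0 <= m x.
  have -> : m x = u x + 2^-1 * (v x - u x) by [].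
  by have := u0 x; have := v0 x; lra.
have := umin m mW m0; have := vmin m mW m0.
have vE : v = u + 1 *: (v - u) by rewrite scale1r addrC subrK.
have -> : energy v = energy (u + 1 *: (v - u)) by rewrite -vE.
rewrite /m !energy_line//; lra.
Qed.

End minimization.

(** * The test function of Picone's identity *)

Section test_function.
Context {R : realType} {n : nat}.
Local Notation Rn := 'rV[R]_n.
Local Notation F := (Rn -> R^o).
Local Notation leb := (@lebesgue_rV R n).
Variables (Omega : set Rn) (V : Rn -> R).
Hypothesis oOmega : open Omega.
Hypothesis V1 : L1loc Omega (fun x => (V x)%:E).

(** The test function [xi ^+ 2 / u] of Picone's identity, with [u] shifted away
from 0. *)
Definition picone (r : R) (xi u : F) : F := fun x => xi x ^+ 2 / (u x + r).

Section fixed.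
Variables (r : R) (xi u : F).
Hypothesis r0 : 0 < r.
Hypothesis xiW : W1infc Omega xi.
Hypothesis uW : W1infc Omega u.
Hypothesis u0 : forall x, 0 <= u x.

Let ur0 x : 0 < u x + r. Proof. by rewrite ltr_wpDl. Qed.

Lemma picone_ge0 x : 0 <= picone r xi u x.
Proof. by rewrite divr_ge0 ?sqr_ge0// ltW. Qed.

(** [u + r >= r > 0], so the quotient of bounded Lipschitz functions is
Lipschitz. *)
Lemma picone_W1infc : W1infc Omega (picone r xi u).
Proof.
apply: (W1infc_sub xiW xiW) => [|x xi0 _]; last by rewrite /picone xi0 expr0n mul0r.
have [/lipschitzP[L L0 xiL] _ _] := xiW.
have [/lipschitzP[L' L'0 uL] _ _] := uW.
have [M M0 xiM] := W1infc_bounded xiW.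
apply/lipschitzP; exists (2 * M * L / r + M ^+ 2 * L' / r ^+ 2).
  by rewrite addr_ge0// divr_ge0 ?mulr_ge0 ?sqr_ge0// ltW.
move=> x y.
have -> : picone r xi u x - picone r xi u y =
    (xi x + xi y) * (xi x - xi y) / (u x + r)
    - xi y ^+ 2 * (u x - u y) / ((u x + r) * (u y + r)).
  by rewrite /picone; field; rewrite !gt_eqF.
apply: le_trans (ler_normB _ _) _; rewrite [leRHS]mulrDl; apply: lerD.
  rewrite normrM normfV (gtr0_norm (ur0 x)) mulrAC; apply: ler_pM => //.
  - by rewrite invr_ge0 ltW.
  - rewrite normrM -(mulrA (2 * M)); apply: ler_pM => //.
    by rewrite (le_trans (ler_normD _ _))// mulr2n mulrDl !mul1r lerD.
  - by rewrite lef_pV2 ?posrE// lerDr.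
rewrite normrM normfV [leRHS]mulrAC; apply: ler_pM => //.
- rewrite normrM -[leRHS]mulrA; apply: ler_pM => //.
  by rewrite normrX lerXn2r ?nnegrE.
- rewrite gtr0_norm ?mulr_gt0// lef_pV2 ?posrE ?mulr_gt0 ?exprn_gt0//.
  by rewrite expr2; apply: ler_pM; rewrite ?lerDr//; exact: ltW.
Qed.

Lemma pderiv_picone i x : derivable xi x (delta_mx ord0 i) ->
  derivable u x (delta_mx ord0 i) ->
  pderiv i (picone r xi u) x =
    2 * xi x * pderiv i xi x / (u x + r)
    - xi x ^+ 2 * pderiv i u x / (u x + r) ^+ 2.
Proof.
move=> dxi du.
pose v : Rn -> R := fun y => u y + r.
have dv : derivable v x (delta_mx ord0 i) by apply: derivableD.
have v0 : v x != 0 by rewrite gt_eqF// /v ur0.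
have vE : 'D_(delta_mx ord0 i) v x = pderiv i u x.
  rewrite (_ : v = u + cst r) // deriveD ?derive_cst ?addr0//.
have -> : picone r xi u = (xi : Rn -> R) ^+ 2 * (fun y => (v y)^-1).
  by apply/funext => y; rewrite /picone fctE.
rewrite /pderiv deriveM; last 2 first.
- exact: derivableX.
- exact: derivableV.
rewrite deriveX// deriveV// vE !fctE.
rewrite -!/(pderiv _ _ _) /v.
have scE (p q : R) : p *: (q : R^o) = p * q by [].
rewrite !scE expr1; field; exact: lt0r_neq0.
Qed.

(** With [a] the derivative of [xi], [b = xi * u' / (u + r)] and
[s = xi / (u + r)], the products [u' * phi'] and [phi' ^+ 2] for
[phi = picone r xi u] are [b * (2 * a - b)] and [(s * (2 * a - b)) ^+ 2].
Without the second term this is Picone's inequality [2 * a * b - b ^+ 2 <= a ^+ 2].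
The second term, weighted by the step [r ^+ 3] of the variation, costs the factor
[1 + r * M ^+ 2]: with [d = r * M ^+ 2 / 2], the right-hand side exceeds the left
one by at least [(1 - 2 * d) * (a - b) ^+ 2 + d * b ^+ 2]. *)
Lemma picone_pointwise (M a b s : R) :
  r * M ^+ 2 <= 1 -> `|s| <= M / r ->
  b * (2 * a - b) + r ^+ 3 / 2 * (s * (2 * a - b)) ^+ 2 <= (1 + r * M ^+ 2) * a ^+ 2.
Proof.
move=> rM sM.
have s2 : s ^+ 2 <= M ^+ 2 / r ^+ 2.
  rewrite -real_normK ?num_real// -expr_div_n lerXn2r ?nnegrE//.
  exact: le_trans sM.
pose d := r * M ^+ 2 / 2.
apply: (@le_trans _ _ (b * (2 * a - b) + d * (2 * a - b) ^+ 2)).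
  rewrite lerD2l exprMn mulrA ler_wpM2r ?sqr_ge0//.
  apply: (@le_trans _ _ (r ^+ 3 / 2 * (M ^+ 2 / r ^+ 2))).
    by rewrite ler_wpM2l// divr_ge0// exprn_ge0// ltW.
  rewrite le_eqVlt; apply/orP; left; apply/eqP; rewrite /d; field.
  by rewrite gt_eqF.
rewrite (_ : r * M ^+ 2 = 2 * d); last by rewrite /d; field.
have d0 : 0 <= d by rewrite divr_ge0// mulr_ge0 ?sqr_ge0// ltW.
have d1 : 2 * d <= 1 by rewrite (_ : 2 * d = r * M ^+ 2)// /d; field.
rewrite -subr_ge0 (_ : _ - _ = (1 - 2 * d) * (a - b) ^+ 2 + d * b ^+ 2); last by ring.
by rewrite addr_ge0// mulr_ge0 ?sqr_ge0// subr_ge0.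
Qed.

End fixed.

Definition absV_energy (xi : F) : R := \int[leb]_(x in Omega) (`|V x| * (xi x * xi x)).

Lemma integrable_absV xi : W1infc Omega xi ->
  leb.-integrable Omega (EFin \o (fun x => `|V x| * (xi x * xi x))).
Proof.
move=> xiW; have := integrable_abse (integrable_potential oOmega V1 xiW xiW).
apply: eq_integrable; first exact: open_measurable_rV.
by move=> x _ /=; rewrite normrM (ger0_norm (_ : 0 <= xi x * xi x))// -expr2 sqr_ge0.
Qed.

End test_function.

Section key_estimate.
Context {R : realType} {n : nat}.
Local Notation Rn := 'rV[R]_n.
Local Notation F := (Rn -> R^o).
Local Notation leb := (@lebesgue_rV R n).
Variables (Omega : set Rn) (V : Rn -> R).
Hypothesis oOmega : open Omega.
Hypothesis V1 : L1loc Omega (fun x => (V x)%:E).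
Variable f : Rn -> R.
Hypothesis mf : measurable_fun setT f.
Hypothesis f01 : forall x, 0 <= f x <= 1.

(** Variation of the almost minimizer in the direction of the test function, with
shift [r], step [r ^+ 3] and error [r ^+ 4].  These powers make both the loss
[r ^+ 3 * M ^+ 2 / r ^+ 2] in Picone's inequality and the quotient
[r ^+ 4 / r ^+ 3] of order [r]. *)
Lemma key_estimate (r M : R) (xi u : F) : 0 < r -> W1infc Omega xi ->
  (forall x, `|xi x| <= M) -> r * M ^+ 2 <= 1 ->
  near_minimizer Omega V f (r ^+ 4) u ->
  source Omega f (picone r xi u) <=
    (1 + r * M ^+ 2) * (\int[leb]_(x in Omega) gradM xi xi x)
    + \int[leb]_(x in Omega) (V x * (u x * picone r xi u x))
    + r * M ^+ 2 / 2 * absV_energy Omega V xi + r.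
Proof.
move=> r0 xiW xiM rM umin; have [uW u0 _] := umin.
have mO := open_measurable_rV oOmega.
have ur0 x : 0 < u x + r by rewrite ltr_wpDl.
have pW := picone_W1infc r0 xiW uW u0.
have := near_minimizer_variation oOmega V1 mf f01 umin pW
  (picone_ge0 xi r0 u0) (exprn_gt0 3 r0).
rewrite (_ : r ^+ 4 / r ^+ 3 = r); last by field; rewrite gt_eqF.
move=> /le_trans; apply; rewrite lerD2r.
have Zi (c : R) g : leb.-integrable Omega (EFin \o g) ->
    leb.-integrable Omega (EFin \o (fun x => c * g x)).
  by move=> gi; have := integrableZl mO c gi; apply: eq_integrable.
have Di g h : leb.-integrable Omega (EFin \o g) -> leb.-integrable Omega (EFin \o h) ->
    leb.-integrable Omega (EFin \o (fun x => g x + h x)).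
  by move=> gi hi; have := integrableD mO gi hi; apply: eq_integrable.
have i1 := integrable_Qform oOmega V1 uW pW.
have i2 := Zi (r ^+ 3 / 2) _ (integrable_Qform oOmega V1 pW pW).
have i3 := Zi (1 + r * M ^+ 2) _ (integrable_gradM oOmega xiW xiW).
have i4 := integrable_potential oOmega V1 uW pW.
have i5 := Zi (r * M ^+ 2 / 2) _ (integrable_absV oOmega V1 xiW).
rewrite Q_Qform /Qform /absV_energy.
rewrite -(RintegralZl _ mO (integrable_absV oOmega V1 xiW)).
rewrite -(RintegralZl _ mO (integrable_gradM oOmega xiW xiW)).
rewrite -(RintegralZl _ mO (integrable_Qform oOmega V1 pW pW)).
rewrite -RintegralD// -RintegralD// -RintegralD//; last exact: Di.
apply: Rintegral_ae_le => //; [exact: Di|exact: (Di _ _ (Di _ _ i3 i4) i5)|].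
apply: filterS2 (ae_pderivable (W1infc_lip xiW)) (ae_pderivable (W1infc_lip uW)).
move=> x dxi du _.
set p := picone r xi u.
have sM : `|xi x / (u x + r)| <= M / r.
  rewrite normrM normfV (gtr0_norm (ur0 x)); apply: ler_pM => //.
    by rewrite invr_ge0 ltW.
  by rewrite lef_pV2 ?posrE// lerDr.
have Vp : r ^+ 3 / 2 * (V x * (p x * p x)) <= r * M ^+ 2 / 2 * (`|V x| * (xi x * xi x)).
  have s0 : 0 <= (xi x / (u x + r)) ^+ 2 by exact: sqr_ge0.
  have ps : p x * p x = (xi x / (u x + r)) ^+ 2 * (xi x * xi x).
    by rewrite /p /picone; field; rewrite gt_eqF.
  have s2 : (xi x / (u x + r)) ^+ 2 <= M ^+ 2 / r ^+ 2.
    rewrite -real_normK ?num_real// -expr_div_n lerXn2r ?nnegrE//.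
    exact: le_trans sM.
  rewrite ps; set s2' := (xi x / (u x + r)) ^+ 2 in s0 s2 *.
  have xx : 0 <= xi x * xi x by rewrite -expr2 sqr_ge0.
  apply: (@le_trans _ _ (r ^+ 3 / 2 * (`|V x| * (M ^+ 2 / r ^+ 2 * (xi x * xi x))))).
    rewrite ler_wpM2l//; first by rewrite divr_ge0// exprn_ge0// ltW.
    apply: (@le_trans _ _ (`|V x| * (s2' * (xi x * xi x)))).
      by apply: ler_wpM2r; [exact: mulr_ge0|exact: ler_norm].
    by rewrite ler_wpM2l// ler_wpM2r.
  have alg (v q : R) : r ^+ 3 / 2 * (v * (M ^+ 2 / r ^+ 2 * q)) = r * M ^+ 2 / 2 * (v * q).
    by field; rewrite gt_eqF.
  by rewrite alg.
have grad : gradM u p x + r ^+ 3 / 2 * gradM p p x <= (1 + r * M ^+ 2) * gradM xi xi x.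
  rewrite /gradM !mulr_sumr -big_split/=; apply: ler_sum => i _.
  have := picone_pointwise r0 (pderiv i xi x) (xi x * pderiv i u x / (u x + r)) rM sM.
  rewrite /p pderiv_picone//; apply: le_trans.
  rewrite le_eqVlt; apply/orP; left; apply/eqP; field; by rewrite gt_eqF.
rewrite mulrDr; move: Vp grad.
set A := gradM u p x; set B := gradM p p x; set C := gradM xi xi x; lra.
Qed.

End key_estimate.

(** * The limit of the almost minimizers and the Hardy inequality *)

Lemma measurable_invr {R : realType} : measurable_fun setT (fun y : R => y^-1).
Proof.
rewrite -(setUv [set 0 : R]); apply/measurable_funU => //.
  exact: measurableC.
split; first exact: measurable_fun_set1.
apply: open_continuous_measurable_fun.
  by apply: closed_openC; exact: closed_eq.
by move=> x; rewrite inE => /eqP x0; apply: cvgV => //; exact: cvg_id.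
Qed.

Section ground_state.
Context {R : realType} {n : nat}.
Local Notation Rn := 'rV[R]_n.
Local Notation F := (Rn -> R^o).
Local Notation leb := (@lebesgue_rV R n).
Variables (Omega : set Rn) (V : Rn -> R).
Hypothesis oOmega : open Omega.
Hypothesis V1 : L1loc Omega (fun x => (V x)%:E).
Variable f : Rn -> R.
Hypothesis mf : measurable_fun setT f.
Hypothesis f01 : forall x, 0 <= f x <= 1.
Hypothesis fpos : forall x, Omega x -> 0 < f x.
Hypothesis fQ : forall u, W1infc Omega u ->
  (\int[leb]_(x in Omega) (f x * `|u x|)%:E <= (Num.sqrt (Q Omega V u))%:E)%E.

Definition scale (k : nat) : R := 2^-1 ^+ k.

Lemma scale_gt0 k : 0 < scale k.
Proof. by rewrite exprn_gt0// invr_gt0. Qed.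

Lemma scale_le1 k : scale k <= 1.
Proof. by rewrite exprn_ile1// invf_le1// ler1n. Qed.

Lemma cvg_scale : scale @ \oo --> 0.
Proof. by apply: cvg_expr; rewrite ger0_norm ?invr_ge0// invf_lt1// ltr1n. Qed.

Variable u : nat -> F.
Hypothesis umin : forall k, near_minimizer Omega V f (scale k ^+ 4) (u k).

Let uW k : W1infc Omega (u k). Proof. by have [] := umin k. Qed.
Let u0 k x : 0 <= u k x. Proof. by have [] := umin k. Qed.
Let mO : measurable Omega. Proof. exact: open_measurable_rV. Qed.
Let mu_ k : measurable_fun Omega (u k).
Proof. exact: measurable_funTS (W1infc_measurable (uW k)). Qed.
Let mfO : measurable_fun Omega f. Proof. exact: measurable_funTS. Qed.

(** An upper limit, so that the function is defined and measurable also where the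
sequence diverges. *)
Definition ground (x : Rn) : R := fine (limn_esup (fun k => (u k x)%:E)).

Lemma ground_ge0 x : 0 <= ground x.
Proof.
rewrite fine_ge0// limn_esup_lim; apply: lime_ge; first exact: is_cvg_esups.
apply: nearW => k; apply: (@le_trans _ _ (u k x)%:E); first by rewrite lee_fin.
by apply: ereal_sup_ubound; exists k => /=.
Qed.

Lemma measurable_ground : measurable_fun Omega ground.
Proof.
apply: (measurableT_comp (@fine_measurable R setT measurableT)).
apply: measurable_fun_limn_esup => k; exact/measurable_EFinP.
Qed.

(** Written with [2 ^ k.+1] in the denominator, the form in which the geometric
series is summed below. *)
Lemma increment_bound k :
  (\int[leb]_(x in Omega) (f x * `|u k.+1 x - u k x|)%:E <= (6 / (2 ^ k.+1)%:R)%:E)%E.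
Proof.
apply: le_trans (fQ (W1infcB (uW k.+1) (uW k))) _; rewrite lee_fin.
have -> : 6 / (2 ^ k.+1)%:R = 3 * scale k.
  rewrite /scale natrX exprS exprVn; field.
  by rewrite expf_neq0.
have s0 := scale_gt0 k; have s1 := scale_le1 k.
rewrite -[leRHS]ger0_norm ?mulr_ge0//; last exact: ltW.
rewrite -sqrtr_sqr ler_wsqrtr// exprMn.
apply: le_trans (near_minimizer_close oOmega V1 mf f01 (umin k) (umin k.+1)) _.
have -> : scale k.+1 = scale k / 2 by rewrite /scale exprS mulrC.
rewrite expr_div_n -[scale k ^+ 4]/(scale k ^+ (2 * 2)) exprM.
set q := scale k ^+ 2; have q0 : 0 <= q by exact: sqr_ge0.
have q1 : q <= 1 by rewrite exprn_ile1// ltW.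
have : q ^+ 2 <= q by rewrite expr2 ler_piMr.
rewrite (_ : (3 : R) ^+ 2 = 9); last by ring.
rewrite (_ : (2 : R) ^+ 4 = 16); last by ring.
lra.
Qed.

Definition majorant (x : Rn) : \bar R :=
  ((f x * u 0 x)%:E + \sum_(k <oo) (f x * `|u k.+1 x - u k x|)%:E)%E.

Let f0 x : 0 <= f x. Proof. by have /andP[] := f01 x. Qed.

Let mincr k : measurable_fun Omega (fun x => (f x * `|u k.+1 x - u k x|)%:E).
Proof.
apply/measurable_EFinP; apply: measurable_funM => //.
by apply: measurableT_comp => //; exact: measurable_funB.
Qed.

Lemma majorant_ge0 x : (0 <= majorant x)%E.
Proof.
rewrite adde_ge0 ?lee_fin ?mulr_ge0//.
by apply: nneseries_ge0 => k _ _; rewrite lee_fin mulr_ge0.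
Qed.

Lemma measurable_majorant : measurable_fun Omega majorant.
Proof.
apply: emeasurable_funD; first by apply/measurable_EFinP; exact: measurable_funM.
apply: ge0_emeasurable_sum => // k x _ _; by rewrite lee_fin mulr_ge0.
Qed.

Lemma integral_majorant : (\int[leb]_(x in Omega) majorant x < +oo)%E.
Proof.
rewrite ge0_integralD//; last 4 first.
- by move=> x _; rewrite lee_fin mulr_ge0.
- by apply/measurable_EFinP; exact: measurable_funM.
- by move=> x _; apply: nneseries_ge0 => k _ _; rewrite lee_fin mulr_ge0.
- apply: ge0_emeasurable_sum => // k x _ _; by rewrite lee_fin mulr_ge0.
apply: lte_add_pinfty.
  have /integrable_lty := integrable_source oOmega mf f01 (uW 0).
  by apply.
rewrite integral_nneseries//; last by move=> k x _; rewrite lee_fin mulr_ge0.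
apply: (@le_lt_trans _ _ 6%:E); last exact: ltry.
apply: le_trans (epsilon_trick0 xpredT (ler0n R 6)).
apply: lee_nneseries => [k _ _|k _]; last exact: increment_bound.
by apply: integral_ge0 => x _; rewrite lee_fin mulr_ge0.
Qed.

Lemma integrable_majorant : leb.-integrable Omega majorant.
Proof.
apply/integrableP; split; first exact: measurable_majorant.
by under eq_integral do rewrite gee0_abs ?majorant_ge0//; exact: integral_majorant.
Qed.

(** Where the integrable [majorant] is finite the increments of the sequence are
absolutely summable, since [f] does not vanish. *)
Lemma ground_cvg : {ae leb, forall x, Omega x ->
  (fun k => u k x) @ \oo --> ground x /\ ((f x * ground x)%:E <= majorant x)%E}.
Proof.
apply: filterS (integrable_ae mO integrable_majorant) => x /[swap] Ox /(_ Ox) fin.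
have S0 : (0 <= \sum_(k <oo) (f x * `|u k.+1 x - u k x|)%:E)%E.
  by apply: nneseries_ge0 => k _ _; rewrite lee_fin mulr_ge0.
have Sfin : (\sum_(k <oo) (f x * `|u k.+1 x - u k x|)%:E < +oo)%E.
  move: fin; rewrite /majorant fin_numD => /andP[_]; rewrite ge0_fin_numE//.
have Dfin : (\sum_(k <oo) (`|u k.+1 x - u k x|)%:E < +oo)%E.
  move: Sfin; under eq_eseriesr do rewrite EFinM.
  rewrite nneseriesZl//; apply: contraTT; rewrite -!leNgt !leye_eq => /eqP ->.
  by rewrite gt0_muley// lte_fin fpos.
have cu : cvgn (fun k => u k x).
  have cs : cvgn (series (telescope (fun k => u k x))).
    apply: (@normed_cvg R R^o); apply: nnseries_is_cvg => [k|]; [exact: normr_ge0|exact: Dfin].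
  have -> : (fun k => u k x) = cst (u 0 x) \+ series (telescope (fun k => u k x)).
    by apply/funext => k /=; rewrite -eq_sum_telescope.
  move/cvg_ex : cs => [l ul]; apply/cvg_ex; exists (u 0 x + l).
  apply: (@cvgD R R^o nat \oo _ (cst (u 0 x)) _ (u 0 x) l) => //; exact: cvg_cst.
have cuE : (u k x)%:E @[k --> \oo] --> (limn (fun k => u k x))%:E.
  by apply: cvg_EFin; first by apply: nearW.
have gE : ground x = limn (fun k => u k x).
  by rewrite /ground (cvg_limn_einf_sup cuE).2.
split; first by rewrite gE.
have cfu : (f x * u k x)%:E @[k --> \oo] --> (f x * ground x)%:E.
  apply: cvg_EFin; first by apply: nearW.
  by apply: (@cvgM R nat \oo _ (fun=> f x) (fun k => u k x)); [exact: cvg_cst|rewrite gE].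
rewrite -(cvg_lim _ cfu)//; apply: lime_le; first by apply/cvg_ex; eexists; exact: cfu.
apply: nearW => k.
apply: (@le_trans _ _ ((f x * u 0 x)%:E + \sum_(0 <= j < k) (f x * `|u j.+1 x - u j x|)%:E)%E).
  rewrite sumEFin -EFinD lee_fin -mulr_sumr -mulrDr ler_wpM2l//.
  rewrite [leLHS](eq_sum_telescope (fun k => u k x)) lerD2l.
  by rewrite (le_trans (ler_norm _))// ler_norm_sum.
by rewrite leeD2l// nneseries_lim_ge// => j _ _; rewrite lee_fin mulr_ge0.
Qed.

Lemma integral_ground : (\int[leb]_(x in Omega) (f x * ground x)%:E < +oo)%E.
Proof.
apply: le_lt_trans integral_majorant; apply: ae_ge0_le_integral => //.
- by move=> x _; rewrite lee_fin mulr_ge0// ground_ge0.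
- by apply/measurable_EFinP; apply: measurable_funM => //; exact: measurable_ground.
- by move=> x _; exact: majorant_ge0.
- exact: measurable_majorant.
- by apply: filterS ground_cvg => x + Ox => /(_ Ox)[].
Qed.

Variable xi : F.
Hypothesis xiW : W1infc Omega xi.

Let phi k : F := picone (scale k) xi (u k).
Let phiW k : W1infc Omega (phi k).
Proof. exact: picone_W1infc (scale_gt0 k) xiW (uW k) (u0 k). Qed.
Let phi0 k x : 0 <= phi k x. Proof. exact: picone_ge0 (scale_gt0 k) (u0 k) x. Qed.

Let den0 k x : 0 < u k x + scale k. Proof. by rewrite ltr_wpDl ?scale_gt0. Qed.

Let P k := \int[leb]_(x in Omega) (V x * (u k x * phi k x)).
Let D := \int[leb]_(x in Omega) gradM xi xi x.
Let A := absV_energy Omega V xi.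

Let uphi_le k x : 0 <= u k x * phi k x <= xi x * xi x.
Proof.
rewrite mulr_ge0//= /phi /picone expr2 mulrCA ler_piMr// -?expr2 ?sqr_ge0//.
by rewrite ler_pdivrMr// mul1r lerDl ltW// scale_gt0.
Qed.

Let P_le k : P k <= A.
Proof.
apply: le_Rintegral => //.
- exact: integrable_potential.
- exact: integrable_absV.
- move=> x _; have /andP[p0 p1] := uphi_le k x.
  apply: (@le_trans _ _ (`|V x| * (u k x * phi k x))).
    by rewrite ler_wpM2r// ler_norm.
  by rewrite ler_wpM2l.
Qed.

Let Gk k x : \bar R := (f x * phi k x)%:E.
Let Ginf x := limn_einf (Gk ^~ x).

Let Gk0 k x : (0 <= Gk k x)%E. Proof. by rewrite lee_fin mulr_ge0. Qed.
Let mGk k : measurable_fun Omega (Gk k).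
Proof.
apply/measurable_EFinP; apply: measurable_funM => //.
exact: measurable_funTS (W1infc_measurable (phiW k)).
Qed.

Let Ginf0 x : (0 <= Ginf x)%E.
Proof.
rewrite /Ginf limn_einf_lim; apply: lime_ge; first exact: is_cvg_einfs.
by apply: nearW => k; apply: le_ereal_inf_tmp => _ [m _ <-].
Qed.

Let mGinf : measurable_fun Omega Ginf.
Proof.
rewrite /Ginf /limn_einf; apply: measurableT_comp => //.
by apply: measurable_fun_limn_esup => k; apply: measurableT_comp.
Qed.

Let M := sval (cid2 (W1infc_bounded xiW)).
Let xiM x : `|xi x| <= M. Proof. by rewrite /M; case: cid2. Qed.

Let c k : R := (1 + scale k * M ^+ 2) * D + P k + scale k * M ^+ 2 / 2 * A + scale k.

Let cvg_coef (a : R) : (fun k => scale k * a) @ \oo --> 0.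
Proof.
rewrite -(mul0r a).
by apply: (@cvgM R nat \oo _ (scale) (fun=> a)); [exact: cvg_scale|exact: cvg_cst].
Qed.

Let scale_near : \forall k \near \oo, scale k * M ^+ 2 <= 1.
Proof.
have /cvgrPdist_le/(_ 1 ltr01) := cvg_coef (M ^+ 2).
apply: filterS => k; rewrite sub0r normrN; apply: le_trans; exact: ler_norm.
Qed.

Let int_Gk : \forall k \near \oo, (\int[leb]_(x in Omega) Gk k x <= (c k)%:E)%E.
Proof.
apply: filterS scale_near => k sM.
have := key_estimate oOmega V1 mf f01 (scale_gt0 k) xiW xiM sM (umin k).
rewrite -lee_fin; apply: le_trans.
have i := integrable_source oOmega mf f01 (phiW k).
by rewrite /source /Rintegral fineK; last exact: integrable_fin_num.
Qed.

(** Fatou's lemma combined with the upper bounds [c k] of the integrals.  These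
hold only for large [k]; a maximum makes them hold for all [k] without changing
the limit. *)
Let le_Ginf (l : R) (b : nat -> R) : b @ \oo --> l ->
  (\forall k \near \oo, c k <= b k) -> (\int[leb]_(x in Omega) Ginf x <= l%:E)%E.
Proof.
move=> bl cb; apply: le_trans (fatou leb mO mGk (fun k x _ => Gk0 k x)) _.
pose b' k : \bar R := maxe (b k)%:E (\int[leb]_(x in Omega) Gk k x)%E.
have b'l : b' @ \oo --> l%:E.
  have bl' : (b k)%:E @[k --> \oo] --> l%:E by apply: cvg_EFin; first by apply: nearW.
  apply: cvg_trans bl'; apply: near_eq_cvg.
  near=> k; rewrite /b' max_l//.
  have /le_trans : (\int[leb]_(x in Omega) Gk k x <= (c k)%:E)%E by near: k.
  by apply; rewrite lee_fin; near: k.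
rewrite -(cvg_limn_einf_sup b'l).1 !limn_einf_lim.
apply: lee_lim; [exact: is_cvg_einfs|exact: is_cvg_einfs|].
apply: nearW => k; apply: le_ereal_inf_tmp => _ [m km <-].
apply: (@le_trans _ _ (\int[leb]_(x in Omega) Gk m x)%E).
  by apply: ereal_inf_lbound; exists m.
by rewrite /b' le_max lexx orbT.
Unshelve. all: by end_near. Qed.

Let K := M ^+ 2 * D + M ^+ 2 / 2 * A + 1.

Let cE k : c k = D + P k + scale k * K.
Proof. by rewrite /c /K; ring. Qed.

(** A crude bound, from [u / (u + r) <= 1]; it is needed before the limit is known
to be positive. *)
Let Ginf_fin : (\int[leb]_(x in Omega) Ginf x < +oo)%E.
Proof.
apply: (@le_lt_trans _ _ (D + A)%:E); last exact: ltry.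
apply: (le_Ginf (b := fun k => D + A + scale k * K)).
  rewrite -[X in _ --> X]addr0.
  by apply: (@cvgD R R^o nat \oo _ (fun=> D + A)); [exact: cvg_cst|exact: cvg_coef].
by apply: nearW => k; rewrite cE lerD2r lerD2l.
Qed.

Let good x := (fun k => u k x) @ \oo --> ground x /\ (xi x != 0 -> 0 < ground x).

Let cvg_den x : (fun k => u k x) @ \oo --> ground x ->
  (fun k => u k x + scale k) @ \oo --> ground x.
Proof.
move=> ug; rewrite -[X in _ --> X]addr0.
by apply: (@cvgD R R^o nat \oo _ (fun k => u k x) (scale)) => //; exact: cvg_scale.
Qed.

(** Where [xi] does not vanish but the limit does, the integrand [Gk k x] tends to
infinity, against the finiteness of the integral of [Ginf]. *)
Lemma ground_pos : {ae leb, forall x, Omega x -> xi x != 0 -> 0 < ground x}.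
Proof.
have iG : leb.-integrable Omega Ginf.
  apply/integrableP; split => //.
  by under eq_integral do rewrite gee0_abs//.
apply: filterS2 ground_cvg (integrable_ae mO iG).
move=> x ucvg Gfin Ox xi0.
have [ug _] := ucvg Ox.
rewrite lt_neqAle ground_ge0 andbT; apply/eqP => /esym g0.
have : Ginf x = +oo%E; last by move=> Goo; have := Gfin Ox; rewrite Goo.
rewrite /Ginf; suff /cvg_limn_einf_sup[] : (Gk ^~ x) @ \oo --> +oo%E by [].
apply/cvgeryP.
have xx : 0 < f x * xi x ^+ 2 by rewrite mulr_gt0 ?fpos// lt0r sqrf_eq0 xi0 sqr_ge0.
apply/gtr0_cvgV0.
  by apply: nearW => k; rewrite /phi /picone mulrA divr_gt0.
change ((fun k => (f x * phi k x)^-1) @ \oo --> 0).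
have -> : (fun k => (f x * phi k x)^-1) =
    (fun k => (u k x + scale k) * (f x * xi x ^+ 2)^-1).
  by apply/funext => k; rewrite /phi /picone /= mulrA invf_div.
rewrite -(mul0r (f x * xi x ^+ 2)^-1).
apply: (@cvgM R nat \oo _ (fun k => u k x + scale k)); last exact: cvg_cst.
by rewrite -[X in _ --> X]g0; exact: cvg_den.
Qed.

Let good_ae : {ae leb, forall x, Omega x -> good x}.
Proof.
apply: filterS2 ground_cvg ground_pos.
by move=> x ucvg gp Ox; have [ug _] := ucvg Ox; split => // xi0; exact: gp.
Qed.

Let cvg_phi x : good x -> (fun k => phi k x) @ \oo --> xi x ^+ 2 / ground x.
Proof.
move=> [ug gp]; have [xi0|xi0] := eqVneq (xi x) 0.
  rewrite (_ : (fun k => phi k x) = (fun=> xi x ^+ 2 / ground x)); first exact: cvg_cst.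
  by apply/funext => k; rewrite /phi /picone xi0 expr0n !mul0r.
apply: (@cvgM R nat \oo _ (fun=> xi x ^+ 2)); first exact: cvg_cst.
apply: (@cvgV R nat \oo _ (fun k => u k x + scale k)); last exact: cvg_den.
by rewrite gt_eqF// gp.
Qed.

(** [u / (u + r)] tends to 1 where the limit is positive, and is at most 1. *)
Let cvg_P : P @ \oo --> \int[leb]_(x in Omega) (V x * (xi x * xi x)).
Proof.
have iV := integrable_potential oOmega V1 xiW xiW.
have [] := @dominated_convergence _ _ R leb Omega mO
  (fun k x => (V x * (u k x * phi k x))%:E) (fun x => (V x * (xi x * xi x))%:E)
  (fun x => (`|V x| * (xi x * xi x))%:E).
- by move=> k; exact: measurable_int (integrable_potential oOmega V1 (uW k) (phiW k)).
- exact: measurable_int iV.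
- apply: filterS good_ae => x + Ox => /(_ Ox) gx.
  apply: cvg_EFin; first by apply: nearW.
  apply: (@cvgM R nat \oo _ (fun=> V x)); first exact: cvg_cst.
  have [ug gp] := gx.
  have -> : xi x * xi x = ground x * (xi x ^+ 2 / ground x).
    have [->|xi0] := eqVneq (xi x) 0; first by rewrite expr0n !mul0r mulr0.
    by rewrite mulrCA divff ?mulr1 ?expr2// gt_eqF// gp.
  by apply: (@cvgM R nat \oo _ (fun k => u k x)) => //; exact: cvg_phi.
- exact: integrable_absV.
- apply: aeW => x k _ /=; have /andP[p0 p1] := uphi_le k x.
  by rewrite lee_fin normrM ler_wpM2l// ger0_norm.
move=> _ _; rewrite -[X in _ --> X]fineK; last exact: integrable_fin_num iV.
by move=> /fine_cvg.
Qed.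

Lemma measurable_weight : measurable_fun Omega (fun x => (f x / ground x * xi x ^+ 2)%:E).
Proof.
apply/measurable_EFinP; apply: measurable_funM.
  apply: measurable_funM => //; apply: measurableT_comp measurable_invr _.
  exact: measurable_ground.
apply: measurable_funX; exact: measurable_funTS (W1infc_measurable xiW).
Qed.

(** Both sides are limits: [Gk k] converges to the integrand almost everywhere,
and [c k] converges to the energy of [xi]. *)
Lemma hardy_inequality :
  (\int[leb]_(x in Omega) (f x / ground x * xi x ^+ 2)%:E <= (Q Omega V xi)%:E)%E.
Proof.
have -> : (\int[leb]_(x in Omega) (f x / ground x * xi x ^+ 2)%:E =
    \int[leb]_(x in Omega) Ginf x)%E.
  apply: ge0_ae_eq_integral => //.
  - exact: measurable_weight.
  - by move=> x _; rewrite lee_fin mulr_ge0 ?sqr_ge0// divr_ge0// ground_ge0.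
  - apply: filterS good_ae => x + Ox => /(_ Ox) gx.
    rewrite /Ginf (cvg_limn_einf_sup (l := (f x / ground x * xi x ^+ 2)%:E) _).1//.
    apply: cvg_EFin; first by apply: nearW.
    rewrite -mulrA [_^-1 * _]mulrC.
    by apply: (@cvgM R nat \oo _ (fun=> f x)); [exact: cvg_cst|exact: cvg_phi].
have -> : Q Omega V xi = D + \int[leb]_(x in Omega) (V x * (xi x * xi x)).
  rewrite Q_Qform /Qform RintegralD//; first exact: integrable_gradM.
  exact: integrable_potential.
apply: (le_Ginf (b := c)); last by apply: nearW.
rewrite (_ : c = fun k => D + P k + scale k * K); last by apply/funext => k; exact: cE.
rewrite -[X in _ --> X]addr0.
apply: (@cvgD R R^o nat \oo _ (fun k => D + P k)); last exact: cvg_coef.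
by apply: (@cvgD R R^o nat \oo _ (fun=> D) P); [exact: cvg_cst|exact: cvg_P].
Qed.

End ground_state.

(** * The two implications *)

Lemma measurable_invEFin {R : realType} :
  measurable_fun setT (fun y : R => (y%:E)^-1)%E.
Proof.
rewrite -(setUv [set 0 : R]); apply/measurable_funU => //; first exact: measurableC.
split; first exact: measurable_fun_set1.
apply: (eq_measurable_fun (fun y : R => (y^-1)%:E)).
  by move=> y; rewrite inE /= => /eqP y0; rewrite inver (negbTE y0).
by apply/measurable_EFinP; apply: measurable_funS measurable_invr.
Qed.

Section subcritical_equivalence.
Context {R : realType} {n : nat}.
Local Notation Rn := 'rV[R]_n.
Local Notation F := (Rn -> R^o).
Local Notation leb := (@lebesgue_rV R n).
Variables (Omega : set Rn) (V : Rn -> R).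
Hypothesis oOmega : open Omega.
Hypothesis V1 : L1loc Omega (fun x => (V x)%:E).
Hypothesis Q0 : Q_nonneg Omega V.

Lemma W1infc_L1loc u : W1infc Omega u -> L1loc Omega (EFin \o u).
Proof.
move=> uW K cK KO; have [_ cu uO] := uW; have [M M0 uM] := W1infc_bounded uW.
apply: (integrableS (open_measurable_rV oOmega) (compact_measurable_rV cK) KO).
apply: (bounded_integrable oOmega (M := M) cu uO) => //.
  exact: W1infc_measurable uW.
by move=> x /notin_supp.
Qed.

(** The difference of the two sides is [(2 * s - w * `|z|) ^+ 2 / (4 * s * w)]. *)
Lemma weighted_young (s w z : R) : 0 < s -> 0 <= w ->
  (`|z|%:E <= s%:E * (w%:E)^-1 + ((4 * s)^-1 * (w * z ^+ 2))%:E)%E.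
Proof.
move=> s0 w0; rewrite inver; case: eqVneq => [->|wn0].
  by rewrite gt0_muley ?lte_fin// addye// leey.
have {wn0}w0 : 0 < w by rewrite lt_neqAle eq_sym wn0.
rewrite -EFinM -EFinD lee_fin -subr_ge0.
rewrite (_ : _ - _ = (2 * s - w * `|z|) ^+ 2 / (4 * s * w)).
  by rewrite divr_ge0 ?sqr_ge0 ?mulr_ge0// ltW.
rewrite -[z ^+ 2]real_normK ?num_real//; field.
by rewrite !gt_eqF.
Qed.

Lemma L1_subcritical_of_weighted : globally_L2_subcritical Omega V -> L1_subcritical Omega V.
Proof.
move=> [_ [w [w0 w1 wV1 [_ emb]]]]; split => //; split.
  by move=> u uW; exact: W1infc_L1loc.
move=> _ [K [cK KO] <-] x xW e e0.
have mK := compact_measurable_rV cK; have mO := open_measurable_rV oOmega.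
have mw : measurable_fun Omega w by apply/measurable_EFinP; exact: L1loc_measurable w1.
have iV := wV1 K cK KO.
have iVge0 y : K y -> (0 <= ((w y)%:E)^-1)%E.
  by move=> Ky; rewrite inve_ge0 lee_fin w0//; exact: KO.
pose A := fine (\int[leb]_(y in K) ((w y)%:E)^-1)%E.
have AE : (\int[leb]_(y in K) ((w y)%:E)^-1)%E = A%:E.
  by rewrite fineK//; exact: integrable_fin_num.
have A0 : 0 <= A by rewrite fine_ge0// integral_ge0.
(* s makes s * A < e / 2, and e' is such that e' ^+ 2 / (4 * s) = e / 2. *)
pose s := e / (2 * (A + 1)).
have s0 : 0 < s by rewrite divr_gt0// mulr_gt0//; lra.
have sA : s * A < e / 2.
  rewrite /s mulrAC ltr_pdivrMr; last by lra.
  by rewrite (_ : e / 2 * _ = e * (A + 1)) ?ltr_pM2l ?ltrDl//; field.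
pose e' := Num.sqrt (2 * s * e).
have se0 : 0 < 2 * s * e by rewrite mulr_gt0// mulr_gt0.
have e'0 : 0 < e' by rewrite sqrtr_gt0.
have [d d0 dP] := emb _ erefl x xW e' e'0.
exists d => // y yW /(dP y yW); rewrite /=.
set z := y - x => hz.
have zW : W1infc Omega z by exact: W1infcB.
have mz : measurable_fun setT z := W1infc_measurable zW.
have mwz : measurable_fun Omega (fun t => (w t * z t ^+ 2)%:E).
  apply/measurable_EFinP; apply: measurable_funM => //.
  by apply: measurable_funX; exact: measurable_funTS.
have wz0 t : Omega t -> (0 <= (w t * z t ^+ 2)%:E)%E.
  by move=> Ot; rewrite lee_fin mulr_ge0 ?sqr_ge0// w0.
have wzlt : (\int[leb]_(t in Omega) (w t * z t ^+ 2)%:E < (2 * s * e)%:E)%E.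
  rewrite ltNge; apply/negP => h; move: hz; rewrite ltNge => /negP; apply.
  rewrite poweR12_sqrt; last exact: integral_ge0.
  rewrite (_ : e'%:E = sqrte (2 * s * e)%:E)// lee_sqrt//.
  exact: integral_ge0.
have wzK : (\int[leb]_(t in K) (w t * z t ^+ 2)%:E < (2 * s * e)%:E)%E.
  by apply: le_lt_trans wzlt; apply: ge0_subset_integral.
have mi : measurable_fun K (fun t => s%:E * ((w t)%:E)^-1)%E.
  by apply: measurable_funeM; exact: measurable_int iV.
have mwzK : measurable_fun K (fun t => (w t * z t ^+ 2)%:E).
  exact: measurable_funS mwz.
have mwzK' : measurable_fun K (fun t => ((4 * s)^-1 * (w t * z t ^+ 2))%:E).
  by under eq_fun do rewrite EFinM; exact: measurable_funeM.
apply: (@le_lt_trans _ _ (\int[leb]_(t in K)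
    (s%:E * ((w t)%:E)^-1 + ((4 * s)^-1 * (w t * z t ^+ 2))%:E))%E).
  apply: ge0_le_integral => //.
  - apply/measurable_EFinP; apply: measurableT_comp => //; exact: measurable_funTS.
  - exact: emeasurable_funD.
  - by move=> t Kt; apply: weighted_young => //; exact/w0/KO.
rewrite ge0_integralD//; last 2 first.
- by move=> t Kt; rewrite mule_ge0 ?lee_fin ?iVge0//; exact: ltW.
- move=> t Kt; rewrite lee_fin; apply: mulr_ge0.
    by rewrite invr_ge0 mulr_ge0// ltW.
  by rewrite -lee_fin; apply: wz0; exact: KO.
rewrite ge0_integralZl_EFin//; last 2 first.
- exact: measurable_int iV.
- exact: ltW.
under [X in (_ + X)%E]eq_integral do rewrite EFinM.
rewrite ge0_integralZl_EFin//; last 2 first.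
- by move=> t Kt; apply: wz0; exact: KO.
- by rewrite invr_ge0 mulr_ge0// ltW.
rewrite AE -EFinM.
apply: (@lt_le_trans _ _ ((e / 2)%:E + (e / 2)%:E)%E); last by rewrite -EFinD -splitr.
apply: lteD; first by rewrite lte_fin.
rewrite lte_pdivrMl; last by rewrite mulr_gt0.
apply: lt_le_trans wzK _; rewrite -EFinM lee_fin le_eqVlt; apply/orP; left.
by apply/eqP; field.
Qed.


(** The weight is the quotient of the source by the limit of the almost
minimizers. *)
Lemma weighted_of_L1_subcritical : L1_subcritical Omega V -> globally_L2_subcritical Omega V.
Proof.
move=> L1s; split => //.
have mO := open_measurable_rV oOmega.
have [f [mf f01 flow fQ]] := weight_exists oOmega V1 L1s.
have fpos x : Omega x -> 0 < f x.
  move=> Ox; have [k kx] := exhaust_cover oOmega Ox.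
  have [c c0 cf] := flow _ (@exhaust_compact _ _ Omega k) (@exhaust_sub _ _ Omega k).
  exact: lt_le_trans c0 (cf _ kx).
have /choice[u umin] : forall k, exists u, near_minimizer Omega V f (scale k ^+ 4) u.
  by move=> k; apply: near_minimizer_exists => //; rewrite exprn_gt0// scale_gt0.
have f0 x : 0 <= f x by have /andP[] := f01 x.
pose g := ground u; have g0 x : 0 <= g x by exact: ground_ge0 umin x.
pose w x := f x / g x.
have w0 x : 0 <= w x by rewrite divr_ge0.
have mg : measurable_fun Omega g by exact: measurable_ground umin.
have mfO : measurable_fun Omega f by exact: measurable_funTS.
have mw : measurable_fun Omega w.
  by apply: measurable_funM => //; apply: measurableT_comp measurable_invr _.
have wQ xi : W1infc Omega xi ->
    (\int[leb]_(x in Omega) (w x * xi x ^+ 2)%:E <= (Q Omega V xi)%:E)%E.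
  by move=> xiW; exact: hardy_inequality.
have mwxi xi : W1infc Omega xi -> measurable_fun Omega (fun x => (w x * xi x ^+ 2)%:E).
  by move=> xiW; exact: measurable_weight umin _ xiW.
exists w; split.
- by move=> x _; exact: w0.
- move=> K cK KO; have mK := compact_measurable_rV cK.
  have mwK : measurable_fun K (fun x => (w x)%:E).
    by apply/measurable_EFinP; exact: measurable_funS mw.
  have [xi [xiW xi0 xi1]] := cutoff oOmega cK KO.
  apply/integrableP; split => //.
  under eq_integral do rewrite gee0_abs ?lee_fin//.
  apply: (@le_lt_trans _ _ (\int[leb]_(x in Omega) (w x * xi x ^+ 2)%:E)%E); last first.
    by apply: le_lt_trans (wQ _ xiW) _; exact: ltry.
  apply: (@le_trans _ _ (\int[leb]_(x in K) (w x * xi x ^+ 2)%:E)%E).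
    apply: ge0_le_integral => //.
    + by move=> x _; rewrite lee_fin.
    + exact: measurable_funS (mwxi _ xiW).
    + by move=> x Kx; rewrite lee_fin ler_peMr// exprn_ege1// xi1.
  apply: ge0_subset_integral => //; first exact: mwxi.
  by move=> x _; rewrite lee_fin mulr_ge0// sqr_ge0.
- move=> K cK KO; have mK := compact_measurable_rV cK.
  have [c c0 cf] := flow K cK KO.
  have [xi [xiW xi0 xi1]] := cutoff oOmega cK KO.
  have mV : measurable_fun K (fun x => ((w x)%:E)^-1)%E.
    apply: (measurableT_comp measurable_invEFin); exact: measurable_funS mw.
  apply/integrableP; split => //.
  have mfg : measurable_fun Omega (fun x => (f x * g x)%:E).
    by apply/measurable_EFinP; exact: measurable_funM.
  apply: (@le_lt_trans _ _ (\int[leb]_(x in K) ((c ^- 2)%:E * (f x * g x)%:E))%E).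
    apply: ae_ge0_le_integral => //.
    + exact: measurableT_comp.
    + by move=> x _; rewrite -EFinM lee_fin mulr_ge0 ?mulr_ge0// invr_ge0 sqr_ge0.
    + by apply: measurable_funeM; exact: measurable_funS mfg.
    + have gp := ground_pos oOmega V1 mf f01 fpos fQ umin xiW.
      apply: filterS gp => x gp Kx.
      have gx : 0 < g x by apply: gp; [exact: KO|rewrite gt_eqF// (lt_le_trans _ (xi1 _ Kx))].
      have fx : 0 < f x by apply: fpos; exact: KO.
      rewrite gee0_abs ?inve_ge0 ?lee_fin//.
      rewrite inver gt_eqF ?divr_gt0// /w invf_div -EFinM lee_fin.
      rewrite mulrA [X in _ <= X]mulrC ler_pM2l// -[X in X <= _]mul1r ler_pdivrMr//.
      rewrite -mulrA -expr2 mulrC ler_pdivlMr ?exprn_gt0// mul1r.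
      by rewrite lerXn2r ?nnegrE ?(ltW c0) ?(ltW fx) ?cf.
  rewrite ge0_integralZl_EFin//.
  + apply: lte_mul_pinfty; rewrite ?lee_fin ?invr_ge0 ?sqr_ge0//.
    apply: le_lt_trans (integral_ground oOmega V1 mf f01 fpos fQ umin).
    apply: ge0_subset_integral => // x _; rewrite lee_fin; exact: mulr_ge0.
  + by move=> x _; rewrite lee_fin; exact: mulr_ge0.
  + exact: measurable_funS mfg.
  + by rewrite invr_ge0 sqr_ge0.
- split; first by move=> xi xiW; split;
    [exact: measurable_funTS (W1infc_measurable xiW)|exact: le_lt_trans (wQ _ xiW) (ltry _)].
  move=> _ -> x xW e e0; exists e => // y yW /=.
  set z := y - x; have zW : W1infc Omega z by exact: W1infcB.
  apply: le_lt_trans; rewrite poweR12_sqrt; last first.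
    by apply: integral_ge0 => t _; rewrite lee_fin mulr_ge0// sqr_ge0.
  rewrite (_ : (Num.sqrt _)%:E = sqrte (Q Omega V z)%:E)// lee_sqrt ?lee_fin ?Q0//.
  exact: wQ.
Qed.

End subcritical_equivalence.

Unset Implicit Arguments.
Set Strict Implicit.

Theorem proposition9p1 (R : realType) (N : nat) (hN : (1 <= N)%N)
    (Omega : set 'rV[R]_N) (hOmega : is_domain Omega)
    (V : 'rV[R]_N -> R) (hV : L1loc Omega (fun x => (V x)%:E))
    (hQ : Q_nonneg Omega V) :
  (balanced Omega V ->
     L1_subcritical Omega V -> globally_L2_subcritical Omega V) /\
  (globally_L2_subcritical Omega V -> L1_subcritical Omega V).
Proof.
have [_ oOmega _] := hOmega; split => [_|].
  exact: weighted_of_L1_subcritical.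
exact: L1_subcritical_of_weighted.
Qed.
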